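(* Let $\mathfrak{p}$ and $\mathfrak{b}$ be two freely independent elements in a non-commutative probability space $(\mathcal{A},\varphi)$. Suppose that $\mathfrak{p}\mathfrak{b}$ is free Poisson with rate $p\in(0,1]$ and jump size $\alpha>0$. (a) If $\mathfrak{b}$ is a Bernoulli variable with parameter $p$, then $\mathfrak{p}$ is free Poisson with rate $1$ and jump size $\alpha$. (b) If $\mathfrak{p}$ is a free Poisson variable with rate $1$ and jump size $\alpha$, then $\mathfrak{b}$ is a Bernoulli variable with parameter $p$.
   Context: A non-commutative probability space is a pair $(\mathcal{A},\varphi)$ with $\mathcal{A}$ a unital algebra over $\mathbb{C}$ and $\varphi:\mathcal{A}\to\mathbb{C}$ linear with $\varphi(\mathbf{1}_{\mathcal{A}})=1$. Unital subalgebras $(\mathcal{A}_i)_{i\in I}$ are freely independent (free) if $\varphi(a_1\cdots a_k)=0$ whenever $k\ge1$, $a_j\in\mathcal{A}_{i_j}$, $\varphi(a_j)=0$ for all $j$, and $i_1\ne i_2,\ldots,i_{k-1}\ne i_k$. Elements are free if the unital subalgebras they generate are free. Free cumulants $\kappa_n:\mathcal{A}^n\to\mathbb{C}$ are the multilinear functionals determined by $\varphi(a_1\cdots a_n)=\sum_{\pi\in NC(n)}\prod_{V\in\pi}\kappa_{|V|}(a_{i}:i\in V)$ (indices in each block in increasing order), where $NC(n)$ is the set of non-crossing partitions of $\{1,\ldots,n\}$; $\kappa_n(a):=\kappa_n(a,\ldots,a)$. $\mathfrak{p}\in\mathcal{A}$ is free Poisson with rate $\lambda>0$ and jump size $\alpha>0$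 if $\kappa_n(\mathfrak{p})=\lambda\alpha^n$ for all $n\ge1$. $\mathfrak{b}\in\mathcal{A}$ is a Bernoulli variable with parameter $p\in[0,1]$ if $\varphi(\mathfrak{b}^n)=p$ for all $n\ge1$. *)

(* Defs.v *)
From HB Require Import structures.
From mathcomp Require Import all_boot all_order all_algebra.
From mathcomp Require Import boolp classical_sets reals.
From mathcomp Require Import complex.

Set Implicit Arguments.
Unset Strict Implicit.
Unset Printing Implicit Defensive.

Import GRing.Theory.
Local Open Scope ring_scope.
Local Open Scope complex_scope.

(* A non-commutative probability space is given by [A : algType R[i]],
   [phi : {scalar A}] and a proof of [phi 1 = 1]; here [R : realType], so that
   [R[i]] is the field of complex numbers. *)

Definition generated_subalgebra (R : realType) (A : algType R[i])
    (S : set A) : set A :=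
  smallest (fun B : set A => GRing.subalg_closed [in B]) S.

(* A word a_1 ... a_k is given by the first k values of [a : nat -> A], indexed
   from 0; [i j] is the index of the subalgebra containing [a j]. *)
Definition free_subalgebras (R : realType) (A : algType R[i])
    (phi : {scalar A}) (I : Type) (B : I -> set A) : Prop :=
  forall (k : nat) (i : nat -> I) (a : nat -> A),
    (1 <= k)%N ->
    (forall j, (j < k)%N -> B (i j) (a j)) ->
    (forall j, (j < k)%N -> phi (a j) = 0) ->
    (forall j, (j.+1 < k)%N -> i j <> i j.+1) ->
    phi (\prod_(0 <= j < k) a j) = 0.

Definition free_elements (R : realType) (A : algType R[i])
    (phi : {scalar A}) (I : Type) (x : I -> A) : Prop :=
  free_subalgebras phi (fun i => generated_subalgebra [set x i]%classic).

Definition free_pair (R : realType) (A : algType R[i])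
    (phi : {scalar A}) (x y : A) : Prop :=
  free_elements phi (fun i : bool => if i then x else y).

Definition crossing n (V W : {set 'I_n}) : bool :=
  [exists a : 'I_n, exists b : 'I_n, exists c : 'I_n, exists d : 'I_n,
    [&& (a < b)%N, (b < c)%N, (c < d)%N,
        a \in V, c \in V, b \in W & d \in W]].

Definition noncrossing n (P : {set {set 'I_n}}) : bool :=
  finset.partition P [set: 'I_n] &&
  [forall V in P, forall W in P, (V != W) ==> ~~ crossing V W].

(* [enum V] lists the indices of the block [V] in increasing order. *)
Definition subword (T : nmodType) (s : seq T) n (V : {set 'I_n}) : seq T :=
  [seq s`_i | i : 'I_n <- enum V].

(* A family of functionals kappa_n : A^n -> C, n >= 1, is represented by one
   function on sequences: kappa_n(a_1, ..., a_n) is [kappa [:: a_1; ...; a_n]],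
   and the value at [[::]] is irrelevant. *)
Definition multilinear (R : realType) (A : algType R[i])
    (kappa : seq A -> R[i]) : Prop :=
  forall (s1 s2 : seq A) (c : R[i]) (x y : A),
    kappa (s1 ++ (c *: x + y) :: s2) =
    c * kappa (s1 ++ x :: s2) + kappa (s1 ++ y :: s2).

Definition moment_cumulant_formula (R : realType) (A : algType R[i])
    (phi : {scalar A}) (kappa : seq A -> R[i]) : Prop :=
  forall s : seq A, (1 <= size s)%N ->
    phi (\prod_(a <- s) a) =
    \sum_(P : {set {set 'I_(size s)}} | noncrossing P)
      \prod_(V in P) kappa (subword s V).

Definition is_free_cumulants (R : realType) (A : algType R[i])
    (phi : {scalar A}) (kappa : seq A -> R[i]) : Prop :=
  multilinear kappa /\ moment_cumulant_formula phi kappa.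

Lemma size_subword (T : nmodType) (s : seq T) n (V : {set 'I_n}) :
  size (subword s V) = #|V|.
Proof. by rewrite size_map cardE. Qed.

Lemma subword_setT (T : nmodType) (s : seq T) :
  subword s [set: 'I_(size s)] = s.
Proof.
rewrite /subword finset.enum_setT -enumT.
rewrite (map_comp (nth 0 s) (@nat_of_ord (size s))) val_enum_ord.
exact: (mkseq_nth 0 s).
Qed.

Lemma noncrossing_setT n : (0 < n)%N -> noncrossing [set [set: 'I_n]].
Proof.
move=> n0; apply/andP; split; last first.
  apply/'forall_implyP => V /set1P ->.
  by apply/'forall_implyP => W /set1P ->; rewrite eqxx.
apply/and3P; split.
- by rewrite /finset.cover big_set1.
- by apply/finset.trivIsetP => V W /set1P -> /set1P ->; rewrite eqxx.
- apply/negP => /set1P /setP /(_ (Ordinal n0)).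
  by rewrite !inE.
Qed.

Lemma noncrossing_card n (P : {set {set 'I_n}}) (V : {set 'I_n}) :
  noncrossing P -> P != [set [set: 'I_n]] -> V \in P -> (#|V| < n)%N.
Proof.
move=> /andP[/and3P[_ /finset.trivIsetP tP P0] _] PT VP.
rewrite ltn_neqAle -[X in (_ <= X)%N]card_ord max_card andbT.
apply: contra PT => /eqP cV.
have VT : V = [set: 'I_n].
  by apply/eqP; rewrite eqEcard finset.subsetT /= cardsT card_ord cV.
apply/eqP/setP => W; rewrite !inE -VT; apply/idP/eqP => [WP|->//].
apply/eqP/negPn/negP => WV; have := tP _ _ WP VP WV.
rewrite VT -setI_eq0 finset.setIT => /eqP W0.
by rewrite -W0 WP in P0.
Qed.

Fixpoint cumulant_rec (R : realType) (A : algType R[i]) (phi : {scalar A})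
    (m : nat) (s : seq A) : R[i] :=
  if m isn't m'.+1 then 0 else
  phi (\prod_(a <- s) a) -
  \sum_(P : {set {set 'I_(size s)}} |
      noncrossing P && (P != [set [set: 'I_(size s)]]))
    \prod_(V in P) cumulant_rec phi m' (subword s V).

Lemma cumulant_rec_fuel (R : realType) (A : algType R[i]) (phi : {scalar A})
    m m' (s : seq A) : (size s < m)%N -> (size s < m')%N ->
  cumulant_rec phi m s = cumulant_rec phi m' s.
Proof.
elim: m m' s => [//|m IH] [//|m'] s sm sm' /=.
congr (_ - _); apply: eq_bigr => P /andP[ncP PT].
apply: eq_bigr => V VP; have cV := noncrossing_card ncP PT VP.
by apply: IH; rewrite size_subword; apply: leq_trans cV _.
Qed.

Lemma cumulant_rec_multilinear (R : realType) (A : algType R[i])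
  (phi : {scalar A}) m : multilinear (cumulant_rec phi m).
Proof.
elim: m => [|m IH] s1 s2 c x y /=; first by rewrite mulr0 addr0.
set S := (X in _ = c * (_ - X) + _).
set S' := (X in _ = c * _ + (_ - X)).
set S0 := (X in _ - X = _).
have -> : phi (\prod_(a <- s1 ++ (c *: x + y) :: s2) a) =
    c * phi (\prod_(a <- s1 ++ x :: s2) a) + phi (\prod_(a <- s1 ++ y :: s2) a).
  rewrite !big_cat !big_cons /= mulrDl mulrDr -scalerAl -scalerAr.
  by rewrite linearP.
suff -> : S0 = c * S + S' by rewrite mulrBr opprD addrACA.
pose N := size (s1 ++ x :: s2).
have sz z : size (s1 ++ z :: s2) = N by rewrite /N !size_cat.
rewrite /S0 /S /S' !sz -!/N.
rewrite big_distrr -big_split /=; apply: eq_bigr => P /andP[ncP _].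
have i0N : (size s1 < N)%N by rewrite /N size_cat /= addnS ltnS leq_addr.
pose i0 := Ordinal i0N.
have /andP[/and3P[/eqP cP tP _] _] := ncP.
have i0c : i0 \in finset.cover P by rewrite cP inE.
pose V0 := finset.pblock P i0.
have V0P : V0 \in P by rewrite finset.pblock_mem.
have i0V0 : i0 \in V0 by rewrite finset.mem_pblock.
have nthz z z' (i : 'I_N) : i != i0 ->
    (s1 ++ z :: s2)`_i = (s1 ++ z' :: s2)`_i.
  move=> ii0; rewrite !nth_cat; case: ltnP => // le.
  case e : (i - size s1)%N => [|j] //=.
  case/eqP: ii0; apply/val_inj => /=; apply/eqP.
  by rewrite eqn_leq le andbT -subn_eq0 e.
have out z z' V : V \in P -> V != V0 ->
    subword (s1 ++ z :: s2) V = subword (s1 ++ z' :: s2) V.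
  move=> VP VV0; apply/eq_in_map => i; rewrite mem_enum => iV.
  apply: nthz; apply: contra VV0 => /eqP ii0.
  by rewrite /V0 -ii0 (finset.def_pblock tP VP iV).
have [t1 [t2 tE]] : exists t1 t2, forall z,
    subword (s1 ++ z :: s2) V0 = t1 ++ z :: t2.
  have : i0 \in enum V0 by rewrite mem_enum.
  have := enum_uniq V0; rewrite /subword.
  move: (enum V0) => e /[swap] /splitPr[e1 e2].
  rewrite uniq_catC /= mem_cat negb_or => /andP[/andP[n2 n1] _].
  exists [seq (s1 ++ x :: s2)`_i | i : 'I_N <- e1].
  exists [seq (s1 ++ x :: s2)`_i | i : 'I_N <- e2] => z.
  rewrite map_cat /=; congr (_ ++ _ :: _).
  - by apply/eq_in_map => i ie; apply: nthz; apply: contraNneq n1 => <-.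
  - by rewrite nth_cat ltnn subnn.
  - by apply/eq_in_map => i ie; apply: nthz; apply: contraNneq n2 => <-.
have outp z z' :
    \prod_(V in P | V != V0) cumulant_rec phi m (subword (s1 ++ z :: s2) V) =
    \prod_(V in P | V != V0) cumulant_rec phi m (subword (s1 ++ z' :: s2) V).
  by apply: eq_bigr => V /andP[VP VV0]; rewrite (out z z').
rewrite !(bigD1 V0 V0P) !tE (outp _ x) (outp y x) IH.
by rewrite /= mulrDl mulrA.
Qed.

Lemma free_cumulants_exist (R : realType) (A : algType R[i])
  (phi : {scalar A}) : exists kappa, is_free_cumulants phi kappa.
Proof.
exists (fun s => cumulant_rec phi (size s).+1 s); split.
  move=> s1 s2 c x y.
  have e z z' : size (s1 ++ z :: s2) = size (s1 ++ z' :: s2).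
    by rewrite !size_cat.
  by rewrite !(e _ 0); exact: cumulant_rec_multilinear.
move=> s s0; rewrite (bigD1 [set [set: 'I_(size s)]]) /=; last first.
  exact: noncrossing_setT.
rewrite big_set1 subword_setT.
set S := (X in _ + X); set k := (X in X + _).
have -> : k = phi (\prod_(a <- s) a) - S; last by rewrite subrK.
congr (_ - _).
apply: eq_bigr => P /andP[ncP PT]; apply: eq_bigr => V VP.
have cV := noncrossing_card ncP PT VP.
by apply: (@cumulant_rec_fuel _ _ phi (size s) (size (subword s V)).+1);
  rewrite size_subword.
Qed.

Lemma free_cumulants_unique (R : realType) (A : algType R[i])
    (phi : {scalar A}) (kappa kappa' : seq A -> R[i]) :
  is_free_cumulants phi kappa -> is_free_cumulants phi kappa' ->
  forall s, (1 <= size s)%N -> kappa s = kappa' s.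
Proof.
move=> [_ kP] [_ kP'] s.
have [n] := ubnP (size s); elim: n s => // n IH s sn s0.
have := kP _ s0; rewrite (kP' _ s0).
have ncT := noncrossing_setT s0.
rewrite (bigD1 _ ncT) [X in _ = X](bigD1 _ ncT) !big_set1 subword_setT /= => e; apply/esym; move: e.
set X := (X in _ + X = _); set Y := (X in _ = _ + X).
suff -> : X = Y by move/addIr.
apply: eq_bigr => P /andP[ncP PT]; apply: eq_bigr => V VP.
have cV := noncrossing_card ncP PT VP.
apply/esym/IH; rewrite size_subword; first by apply: leq_trans cV _.
rewrite card_gt0; apply: contraTneq VP => ->.
by case/andP: ncP => /and3P[].
Qed.

Definition free_cumulant (R : realType) (A : algType R[i])
    (phi : {scalar A}) : seq A -> R[i] :=
  sval (cid (free_cumulants_exist phi)).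

Lemma free_cumulantP (R : realType) (A : algType R[i]) (phi : {scalar A}) :
  is_free_cumulants phi (free_cumulant phi).
Proof. exact: svalP. Qed.

Definition free_cumulant1 (R : realType) (A : algType R[i])
    (phi : {scalar A}) (n : nat) (a : A) : R[i] :=
  free_cumulant phi (nseq n a).

Definition free_poisson (R : realType) (A : algType R[i])
    (phi : {scalar A}) (lambda alpha : R) (x : A) : Prop :=
  [/\ 0 < lambda, 0 < alpha &
      forall n, (1 <= n)%N ->
        free_cumulant1 phi n x = (lambda * alpha ^+ n)%:C].

Definition bernoulli_variable (R : realType) (A : algType R[i])
    (phi : {scalar A}) (p : R) (x : A) : Prop :=
  0 <= p <= 1 /\ forall n, (1 <= n)%N -> phi (x ^+ n) = p%:C.

(* Main.v *)
Require Import Defs.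
From HB Require Import structures.
From mathcomp Require Import all_boot all_order all_algebra.
From mathcomp Require Import boolp classical_sets reals complex ring zify.
Set Implicit Arguments.
Unset Strict Implicit.
Unset Printing Implicit Defensive.
Import Order.TTheory GRing.Theory Num.Theory.
Local Open Scope ring_scope.
Local Open Scope complex_scope.

(** Write a and b for the two free elements, and M_x(t) for the sum of
    phi(x^n) t^n.  Everything takes place in formal power series: those with
    coefficients in A form an algebra over those with complex coefficients, and
    phi acts coefficientwise.

    The multiplicativity of the S-transform is used in the following form
    ([moment_series_free_mul]).  If u, v, z, t are scalar series without
    constant term, z has a nonzero linear term, and
      M_a(u) = 1 + z = M_b(v),   u v (1 + z) = z t,
    then M_ab(t) = 1 + z.  With X = (1 - u a)^-1 and Y = (1 - v b)^-1, let
    X0 = X - (1 + z) and Y0 = Y - (1 + z), whose coefficients are centered.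
    The relation between u, v, z and t gives
      z (1 - t ab) = X^-1 (z (1 + z) - X0 Y0) Y^-1,
    so (1 - t ab)^-1 = Y (1 + Q) with
      z (1 + z) Q = z X0 + X0 Y0 + X0 Y0 Q.
    This determines the coefficients of Q one after the other, and shows that
    they stay orthogonal to every alternating centered word that does not end in
    the algebra of a.  Freeness kills phi(Q) and phi(Y0 Q), and what is left of
    phi((1 - t ab)^-1) is phi(Y) = 1 + z.

    Since u, v and t may be any series, no compositional inverse is needed: one
    of u, v is taken to be the formal variable, and z is then a moment series.

    On the side of cumulants, the n-th moment of a free Poisson variable with
    rate lam and jump size al is al^n times the sum of lam^(number of blocks)
    over the non-crossing partitions of n points.  Splitting such a partition
    at the element that follows the first one inside its block gives a quadratic
    recursion ([sum_first]), that is, M(t) = 1 + w with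
      w = al t (1 + w) (lam + w)   ([poisson_equation]).
    This equation has only one solution, so it characterizes both the moments
    and, by triangularity of the moment-cumulant formula, the free Poisson law.
    For a Bernoulli variable M(t) (1 - t) = 1 - t + p t.

    For (b), v is the variable and u = z / (al (1 + z)^2) is forced by the law of
    a, so t = v / (al (1 + z)), and the equation for ab collapses to
    z = v (p + z): b is Bernoulli.  For (a), u is the variable and
    v = z / (p + z), so t = u (1 + z) / (p + z), and the equation for ab becomes
    z = al u (1 + z)^2: a is free Poisson with rate 1. *)

(** * Formal power series *)

(** Generic in the biadditive operation [op], because multiplication of series
    and scaling of an A-valued series by a scalar series are both instances:
    [cauchyA] and [cauchyC] then give all their associativity and commutation
    laws. *)
Definition cauchy (U V W : zmodType) (op : U -> V -> W)
    (f : nat -> U) (g : nat -> V) (n : nat) : W :=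
  \sum_(i < n.+1) op (f i) (g (n - i)%N).

Lemma cauchy_rev (U V W : zmodType) (op : U -> V -> W) f g n :
  cauchy op f g n = \sum_(i < n.+1) op (f (n - i)%N) (g i).
Proof.
rewrite /cauchy (reindex_inj rev_ord_inj) /=.
by apply: eq_bigr => i _; rewrite subSS subKn // -ltnS.
Qed.

Lemma cauchyC (U V W : zmodType) (op : U -> V -> W) f g :
  cauchy op f g = cauchy (fun y x => op x y) g f.
Proof. by apply: funext => n; rewrite cauchy_rev. Qed.

Lemma cauchyA (U V W UV VW T : zmodType)
    (op1 : UV -> W -> T) (op2 : U -> V -> UV)
    (op3 : U -> VW -> T) (op4 : V -> W -> VW) f g h :
  (forall z, {morph op1^~ z : x y / x + y}) ->
  (forall x, {morph op3 x : y z / y + z}) ->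
  (forall x y z, op1 (op2 x y) z = op3 x (op4 y z)) ->
  cauchy op1 (cauchy op2 f g) h = cauchy op3 f (cauchy op4 g h).
Proof.
move=> D1 D3 A; apply: funext => n; rewrite cauchy_rev /cauchy.
have z1 z : op1 0 z = 0 by apply: (addrI (op1 0 z)); rewrite -D1 !addr0.
have z3 x : op3 x 0 = 0 by apply: (addrI (op3 x 0)); rewrite -D3 !addr0.
pose G j k := op3 (f j) (op4 (g (n - j - k)%N) (h k)).
transitivity (\sum_(k < n.+1) \sum_(j < n.+1 | (j <= n - k)%N) G j k).
  apply: eq_bigr => k _; rewrite (big_morph (op1^~ _) (D1 _) (z1 _)).
  rewrite (big_ord_narrow_leq (leq_subr _ _)) /=; apply: eq_bigr => j _.
  by rewrite /G A -!subnDA addnC.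
rewrite (exchange_big_dep predT) //=; apply: eq_bigr => j _.
transitivity (\sum_(k < n.+1 | (k <= n - j)%N) G j k).
  apply: eq_bigl => k; rewrite -ltnS -(ltnS k) -!subSn ?leq_ord //.
  by rewrite -subn_gt0 -(subn_gt0 k) -!subnDA addnC.
rewrite (big_ord_narrow_leq (leq_subr _ _)) /=.
rewrite -(big_morph (op3 _) (D3 _) (z3 _)).
by congr (op3 _ _); exact: (esym (cauchy_rev op4 g h _)).
Qed.

(** An alias, so that the ring structure is the Cauchy product and not the
    pointwise one. *)
Definition fps (S : Type) := nat -> S.

HB.instance Definition _ (S : choiceType) := Choice.on (fps S).

Section FpsZmod.
Variable S : zmodType.
Implicit Types f g : fps S.

Definition fps_add f g : fps S := fun n => f n + g n.
Definition fps_opp f : fps S := fun n => - f n.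
Definition fps_zero : fps S := fun _ => 0.

Lemma fps_addA : associative fps_add.
Proof. by move=> f g h; apply: funext => n; apply: addrA. Qed.
Lemma fps_addC : commutative fps_add.
Proof. by move=> f g; apply: funext => n; apply: addrC. Qed.
Lemma fps_add0 : left_id fps_zero fps_add.
Proof. by move=> f; apply: funext => n; apply: add0r. Qed.
Lemma fps_addN : left_inverse fps_zero fps_opp fps_add.
Proof. by move=> f; apply: funext => n; apply: addNr. Qed.

HB.instance Definition _ := GRing.isZmodule.Build (fps S)
  fps_addA fps_addC fps_add0 fps_addN.

Lemma fpsD f g n : (f + g) n = f n + g n. Proof. by []. Qed.
Lemma fpsN f n : (- f) n = - f n. Proof. by []. Qed.
Lemma fpsB f g n : (f - g) n = f n - g n. Proof. by []. Qed.

Definition fpsC (a : S) : fps S := fun n => if n is 0 then a else 0.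

End FpsZmod.

Lemma cauchyDl (U V W : zmodType) (op : U -> V -> W) :
  (forall z, {morph op^~ z : x y / x + y}) ->
  forall h, {morph cauchy op ^~ h : f g / (f : fps U) + g >-> (f : fps W) + g}.
Proof.
move=> D h f g; apply: funext => n; rewrite fpsD /cauchy -big_split.
by apply: eq_bigr => i _; rewrite D.
Qed.

Lemma cauchyDr (U V W : zmodType) (op : U -> V -> W) :
  (forall z, {morph op z : x y / x + y}) ->
  forall h, {morph cauchy op h : f g / (f : fps V) + g >-> (f : fps W) + g}.
Proof.
move=> D h f g; apply: funext => n; rewrite fpsD /cauchy -big_split.
by apply: eq_bigr => i _; rewrite D.
Qed.

Lemma cauchy_Cl (U V W : zmodType) (op : U -> V -> W) a g n :
  (forall z, op 0 z = 0) -> cauchy op (fpsC a) g n = op a (g n).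
Proof.
by move=> op0; rewrite /cauchy big_ord_recl subn0 big1 ?addr0.
Qed.

Lemma cauchy_Cr (U V W : zmodType) (op : U -> V -> W) f b n :
  (forall z, op z 0 = 0) -> cauchy op f (fpsC b) n = op (f n) b.
Proof. by move=> op0; rewrite cauchyC cauchy_Cl. Qed.

Section FpsRing.
Variable S : nzRingType.
Implicit Types f g : fps S.

Definition fps_mul (f g : fps S) : fps S := cauchy *%R f g.

Lemma fps_mulA : associative fps_mul.
Proof.
move=> f g h; apply/esym/cauchyA.
- by move=> z x y; apply: mulrDl.
- by move=> z x y; apply: mulrDr.
- by move=> x y z; rewrite mulrA.
Qed.
Lemma fps_mul1 : left_id (fpsC 1) fps_mul.
Proof.
move=> f; apply: funext => n.
by rewrite /fps_mul cauchy_Cl ?mul1r // => z; rewrite mul0r.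
Qed.
Lemma fps_mulr1 : right_id (fpsC 1) fps_mul.
Proof.
move=> f; apply: funext => n.
by rewrite /fps_mul cauchy_Cr ?mulr1 // => z; rewrite mulr0.
Qed.
Lemma fps_mulDl : left_distributive fps_mul +%R.
Proof.
by move=> f g h; apply: (@cauchyDl _ _ _ *%R) => z x y; apply: mulrDl.
Qed.
Lemma fps_mulDr : right_distributive fps_mul +%R.
Proof.
by move=> f g h; apply: (@cauchyDr _ _ _ *%R) => z x y; apply: mulrDr.
Qed.
Lemma fps_1neq0 : fpsC 1 != 0 :> fps S.
Proof. by apply/eqP => /(congr1 (@^~ 0)) /eqP; rewrite oner_eq0. Qed.

HB.instance Definition _ := GRing.Zmodule_isNzRing.Build (fps S)
  fps_mulA fps_mul1 fps_mulr1 fps_mulDl fps_mulDr fps_1neq0.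

Lemma fpsM f g n : (f * g) n = \sum_(i < n.+1) f i * g (n - i)%N.
Proof. by []. Qed.
Lemma fps1 n : (1 : fps S) n = (n == 0)%:R.
Proof. by case: n. Qed.

End FpsRing.

Lemma fps_mulC (R : comNzRingType) : commutative (@fps_mul R).
Proof.
move=> f g; rewrite /fps_mul cauchyC; apply: funext => n.
by apply: eq_bigr => i _; apply: mulrC.
Qed.

HB.instance Definition _ (R : comNzRingType) :=
  GRing.PzRing_hasCommutativeMul.Build (fps R) (@fps_mulC R).

Section FpsAlgebra.
Variables (R : comNzRingType) (A : algType R).

Definition fps_scale (c : fps R) (f : fps A) : fps A := cauchy *:%R c f.

Lemma fps_scaleA c d f : fps_scale c (fps_scale d f) = fps_scale (c * d) f.
Proof.
apply/esym/cauchyA.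
- by move=> z x y; apply: scalerDl.
- by move=> z x y; apply: scalerDr.
- by move=> x y z; rewrite scalerA.
Qed.
Lemma fps_scale1 : left_id 1 fps_scale.
Proof.
move=> f; apply: funext => n.
by rewrite /fps_scale cauchy_Cl ?scale1r // => z; rewrite scale0r.
Qed.
Lemma fps_scaleDr : right_distributive fps_scale +%R.
Proof.
by move=> c f g; apply: (@cauchyDr _ _ _ *:%R) => z x y; apply: scalerDr.
Qed.
Lemma fps_scaleDl f : {morph fps_scale^~ f : c d / c + d}.
Proof.
by move=> c d; apply: (@cauchyDl _ _ _ *:%R) => z x y; apply: scalerDl.
Qed.

HB.instance Definition _ := GRing.Zmodule_isLmodule.Build (fps R) (fps A)
  fps_scaleA fps_scale1 fps_scaleDr fps_scaleDl.

Lemma fps_scaleAl (c : fps R) (f g : fps A) : c *: (f * g) = c *: f * g.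
Proof.
apply/esym/cauchyA.
- by move=> z x y; apply: mulrDl.
- by move=> z x y; apply: scalerDr.
- by move=> x y z; rewrite scalerAl.
Qed.

HB.instance Definition _ := GRing.Lmodule_isLalgebra.Build (fps R) (fps A)
  fps_scaleAl.

Lemma fps_scaleAr (c : fps R) (f g : fps A) : c *: (f * g) = f * (c *: g).
Proof.
rewrite fps_scaleAl; suff -> : c *: f = cauchy (fun x k => k *: x) f c.
  apply: cauchyA.
  - by move=> z x y; apply: mulrDl.
  - by move=> z x y; apply: mulrDr.
  - by move=> x y z; rewrite -scalerAr scalerAl.
by rewrite /GRing.scale /= /fps_scale cauchyC.
Qed.

HB.instance Definition _ := GRing.Lalgebra_isAlgebra.Build (fps R) (fps A)
  fps_scaleAr.

Lemma fpsZ (c : fps R) (f : fps A) n :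
  (c *: f) n = \sum_(i < n.+1) c i *: f (n - i)%N.
Proof. by []. Qed.

End FpsAlgebra.

(** * Geometric series and substitution *)

Section Geometric.
Variable S : nzRingType.
Implicit Types f g : fps S.

Lemma fps_expr_small f k m : f 0 = 0 -> (m < k)%N -> (f ^+ k) m = 0.
Proof.
move=> f0; elim: k m => // k IH m mk.
rewrite exprS fpsM big_ord_recl f0 mul0r add0r big1 // => i _.
rewrite IH ?mulr0 // lift0; case: m mk i => [|m] mk i; first by case: i.
by rewrite subSS ltnS in mk *; apply: leq_ltn_trans mk; apply: leq_subr.
Qed.

(** The series (1 - f)^-1.  Only the powers up to [m] contribute to the
    coefficient of degree [m] when [f] has no constant term. *)
Definition fps_geo f : fps S := fun m => \sum_(k < m.+1) (f ^+ k) m.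

Lemma fps_geo_wide f m n : f 0 = 0 -> (m < n)%N ->
  fps_geo f m = \sum_(k < n) (f ^+ k) m.
Proof.
move=> f0 mn; rewrite /fps_geo (big_ord_widen _ (fun k => (f ^+ k) m) mn).
rewrite big_mkcond; apply: eq_bigr => k _; case: ltnP => // km.
by rewrite fps_expr_small.
Qed.

Lemma fps_geoMr f : f 0 = 0 -> f * fps_geo f = fps_geo f - 1.
Proof.
move=> f0; apply: funext => m; rewrite fpsB (@fps_geo_wide f m m.+2) //.
rewrite big_ord_recl expr0 addrC addKr fpsM.
under eq_bigr => i _.
  rewrite (@fps_geo_wide f _ m.+1) ?ltnS ?leq_subr // mulr_sumr. over.
rewrite exchange_big; apply: eq_bigr => k _.
by rewrite lift0 exprS fpsM.
Qed.

Lemma fps_geoMl f : f 0 = 0 -> fps_geo f * f = fps_geo f - 1.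
Proof.
move=> f0; apply: funext => m; rewrite fpsB (@fps_geo_wide f m m.+2) //.
rewrite big_ord_recl expr0 addrC addKr fpsM.
under eq_bigr => i _.
  rewrite (@fps_geo_wide f _ m.+1) ?mulr_suml; last first.
  - exact: ltn_ord.
  - by [].
  over.
rewrite exchange_big; apply: eq_bigr => k _.
by rewrite lift0 exprSr fpsM.
Qed.

Lemma fps_geoV f : f 0 = 0 -> (1 - f) * fps_geo f = 1.
Proof. by move=> f0; rewrite mulrBl mul1r fps_geoMr // subKr. Qed.

Lemma fps_geoVl f : f 0 = 0 -> fps_geo f * (1 - f) = 1.
Proof. by move=> f0; rewrite mulrBr mulr1 fps_geoMl // subKr. Qed.

(** Fixed-point equations with a contraction [f] have unique solutions; applied
    to the difference of two solutions. *)
Lemma fps_contraction f g : f 0 = 0 -> g = f * g -> g = 0.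
Proof.
move=> f0 e; rewrite -[g]mul1r -(fps_geoVl f0) -mulrA mulrBl mul1r -e subrr.
by rewrite mulr0.
Qed.

Definition fpsX : fps S := fun n => (n == 1)%:R.

Lemma fpsXM f n : (fpsX * f) n = if n is n'.+1 then f n' else 0.
Proof.
rewrite fpsM; case: n => [|n]; first by rewrite big_ord1 mul0r.
rewrite big_ord_recl mul0r add0r big_ord_recl /= mul1r subn1 big1 ?addr0 //.
by move=> i _; rewrite mul0r.
Qed.

End Geometric.
Arguments fpsX {S}.

Lemma fpsC_mul (S : nzRingType) (a b : S) : fpsC (a * b) = fpsC a * fpsC b.
Proof.
apply: funext => n; rewrite /GRing.mul /= /fps_mul cauchy_Cl; last first.
  by move=> z; rewrite mul0r.
by case: n => //=; rewrite mulr0.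
Qed.

Lemma fpsC_exp (S : nzRingType) (a : S) k : fpsC (a ^+ k) = fpsC a ^+ k.
Proof. by elim: k => // k IH; rewrite !exprS fpsC_mul IH. Qed.

Lemma fpsCM (S : nzRingType) (a : S) f n : (fpsC a * f) n = a * f n.
Proof. by apply: cauchy_Cl => z; rewrite mul0r. Qed.

Lemma fpsZC (R : comNzRingType) (A : algType R) (c : fps R) (a : A) n :
  (c *: fpsC a) n = c n *: a.
Proof. by apply: cauchy_Cr => z; rewrite scaler0. Qed.

Lemma fpsC1 (S : nzRingType) : fpsC 1 = 1 :> fps S. Proof. by []. Qed.

Section Composition.
Variable R : comNzRingType.
Implicit Types f g t : fps R.

Definition fps_comp f t : fps R := fun m => \sum_(k < m.+1) f k * (t ^+ k) m.

Lemma fps_comp_wide f t m n : t 0 = 0 -> (m < n)%N ->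
  fps_comp f t m = \sum_(k < n) f k * (t ^+ k) m.
Proof.
move=> t0 mn; rewrite /fps_comp.
rewrite (big_ord_widen _ (fun k => f k * (t ^+ k) m) mn) big_mkcond; apply: eq_bigr => k _; case: ltnP => // km.
by rewrite fps_expr_small // mulr0.
Qed.

Lemma fps_compD f g t : fps_comp (f + g) t = fps_comp f t + fps_comp g t.
Proof.
apply: funext => m; rewrite fpsD /fps_comp -big_split.
by apply: eq_bigr => k _; rewrite fpsD mulrDl.
Qed.

Lemma fps_compC a t : fps_comp (fpsC a) t = fpsC a.
Proof.
apply: funext => m; rewrite /fps_comp big_ord_recl big1.
  by rewrite expr0 fps1 addr0; case: m => [|m] /=; rewrite ?mulr1 ?mulr0.
by move=> i _; rewrite mul0r.
Qed.

Lemma fps_compX t : t 0 = 0 -> fps_comp fpsX t = t.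
Proof.
move=> t0; apply: funext => m; rewrite (@fps_comp_wide _ _ _ m.+2) //.
rewrite big_ord_recl mul0r add0r big_ord_recl mul1r big1 ?addr0 //.
by move=> i _; rewrite mul0r.
Qed.

(** Substitution is multiplicative.  In degree [m] both sides are sums of
    f_k g_l (t^(k+l))_m, over the triangle k + l <= m on one side and over a
    square on the other; the extra terms of the square vanish because t^(k+l)
    starts in degree k + l. *)
Lemma fps_compM f g t : t 0 = 0 ->
  fps_comp (f * g) t = fps_comp f t * fps_comp g t.
Proof.
move=> t0; apply: funext => m; pose H k l := f k * g l * (t ^+ (k + l)) m.
have -> : fps_comp (f * g) t m =
    \sum_(n < m.+1) \sum_(k < m.+1 | (k <= n)%N) H k (n - k)%N.
  apply: eq_bigr => n _; rewrite fpsM mulr_suml.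
  rewrite (big_ord_widen m.+1 (fun i => f i * g (n - i)%N * (t ^+ n) m)) //.
  by apply: eq_bigr => k kn; rewrite /H subnKC.
have -> : (fps_comp f t * fps_comp g t) m =
    \sum_(k < m.+1) \sum_(l < m.+1) H k l.
  rewrite fpsM.
  under eq_bigr => i _.
    rewrite (@fps_comp_wide f t i m.+1) // (@fps_comp_wide g t _ m.+1) //;
      last by rewrite ltnS leq_subr.
    rewrite mulr_suml.
    under eq_bigr do rewrite mulr_sumr.
    over.
  rewrite exchange_big; apply: eq_bigr => k _.
  rewrite exchange_big; apply: eq_bigr => l _.
  rewrite /H exprD fpsM mulr_sumr; apply: eq_bigr => i _.
  by rewrite mulrACA.
rewrite (exchange_big_dep predT) //=; apply: eq_bigr => k _.
rewrite -(big_mkord (fun n => k <= n)%N (fun n => H k (n - k)%N)).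
rewrite -(big_mkord predT (H k)).
rewrite (@big_cat_nat _ _ _ k) //=; last by rewrite ltnW.
rewrite big_nat_cond big_pred0 ?add0r; last first.
  by move=> i; rewrite /=; case: (ltnP i k).
rewrite -{1}[val k]add0n big_addn.
rewrite [RHS](@big_cat_nat _ _ _ (m.+1 - k)) //= ?leq_subr //.
rewrite [X in _ = _ + X]big1_seq ?addr0.
  by apply: eq_big => i; rewrite ?leq_addl // addnK.
move=> i /andP[_]; rewrite mem_index_iota leq_subLR => /andP[im _].
by rewrite /H fps_expr_small ?mulr0.
Qed.

Lemma fps_comp_X f : fps_comp f fpsX = f.
Proof.
apply: funext => m; rewrite /fps_comp big_ord_recr big1 => [|k _] /=.
  suff -> : (fpsX ^+ m : fps R) m = 1 by rewrite add0r mulr1.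
  by elim: m => [|m IH]; rewrite ?expr0 // exprS fpsXM.
suff -> : (fpsX ^+ k : fps R) m = 0 by rewrite mulr0.
have := ltn_ord k; move: (val k) => {}k; elim: k m => [|k IH] [|m] //= km.
by rewrite exprS fpsXM IH.
Qed.

End Composition.

(** * Alternating words and free products *)

Section GeneratedSubalgebra.
Variables (R : realType) (A : algType R[i]) (S : set A).
Local Notation G := (generated_subalgebra S).

Lemma generated_incl x : S x -> G x.
Proof. by move=> Sx B [_]; apply. Qed.

Lemma generated1 : G 1.
Proof. by move=> B [[B1 _ _] _]; have := B1; rewrite inE. Qed.

Lemma generatedP c x y : G x -> G y -> G (c *: x + y).
Proof.
move=> Gx Gy B [cB SB]; have [_ /(_ c x y) + _] := cB.
by rewrite !inE; apply; [apply: Gx | apply: Gy].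
Qed.

Lemma generatedM x y : G x -> G y -> G (x * y).
Proof.
move=> Gx Gy B [cB SB]; have [_ _ /(_ x y)] := cB.
by rewrite !inE; apply; [apply: Gx | apply: Gy].
Qed.

Lemma generated0 : G 0.
Proof.
by rewrite -(addNr 1) -scaleN1r; apply: generatedP generated1 generated1.
Qed.

Lemma generatedZ c x : G x -> G (c *: x).
Proof. by move=> Gx; rewrite -[_ *: _]addr0; apply: generatedP generated0. Qed.

Lemma generatedD x y : G x -> G y -> G (x + y).
Proof. by move=> Gx Gy; rewrite -[x]scale1r; apply: generatedP. Qed.

Lemma generatedX x n : G x -> G (x ^+ n).
Proof.
move=> Gx; elim: n => [|n IH]; first by rewrite expr0; apply: generated1.
by rewrite exprS; apply: generatedM.
Qed.

End GeneratedSubalgebra.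

Section Functional.
Variables (R : realType) (A : algType R[i]) (phi : {scalar A}).
Hypothesis phi1 : phi 1 = 1.

Definition fps_phi (P : fps A) : fps R[i] := fun n => phi (P n).

Lemma fps_phiD P Q : fps_phi (P + Q) = fps_phi P + fps_phi Q.
Proof. by apply: funext => n; rewrite /fps_phi fpsD linearD. Qed.

Lemma fps_phiZ c P : fps_phi (c *: P) = c * fps_phi P.
Proof.
apply: funext => n; rewrite /fps_phi fpsZ fpsM linear_sum.
by apply: eq_bigr => i _; rewrite linearZ.
Qed.

Lemma fps_phi1 : fps_phi 1 = 1.
Proof.
by apply: funext => n; rewrite /fps_phi; case: n => [|n]; rewrite ?linear0.
Qed.

Definition moment_series (x : A) : fps R[i] := fun n => phi (x ^+ n).

Lemma fps_geoZC t (x : A) n :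
  fps_geo (t *: fpsC x) n = \sum_(k < n.+1) (t ^+ k) n *: x ^+ k.
Proof. by apply: eq_bigr => k _; rewrite exprZn -fpsC_exp fpsZC. Qed.

Lemma fps_phi_geo t x :
  fps_phi (fps_geo (t *: fpsC x)) = fps_comp (moment_series x) t.
Proof.
apply: funext => n; rewrite /fps_phi fps_geoZC linear_sum.
by apply: eq_bigr => k _; rewrite linearZ mulrC.
Qed.

End Functional.

Section Freeness.
Variables (R : realType) (A : algType R[i]) (phi : {scalar A}) (x y : A).
Hypothesis phi1 : phi 1 = 1.
Hypothesis xy_free : free_pair phi x y.

Let gen (i : bool) := generated_subalgebra [set (if i then x else y)]%classic.

Definition centered i c := gen i c /\ phi c = 0.

(** Letters carry the index of their algebra.  Appending [i] to the list of
    indices before testing it forbids the last letter to have index [i], and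
    handles the empty word at the same time. *)
Definition alternating i (w : seq (bool * A)) :=
  (forall u, u \in w -> centered u.1 u.2) /\
  sorted (fun j k => j != k) (rcons (unzip1 w) i).

Lemma alternating_rcons i w c : alternating i w -> centered i c ->
  alternating (~~ i) (rcons w (i, c)).
Proof.
move=> [cw sw] ci; split.
  by move=> u; rewrite mem_rcons inE => /orP[/eqP ->|/cw].
rewrite /unzip1 map_rcons /=; move: sw; rewrite -/(unzip1 w).
case: (unzip1 w) => [|j s] /=; first by case: i {ci}.
by rewrite !rcons_path last_rcons => /andP[-> ->] /=; case: i {ci}.
Qed.

Lemma alternating_phi i w : alternating i w -> w != [::] ->
  phi (\prod_(u <- w) u.2) = 0.
Proof.
move=> [cw sw] w0; pose d : bool * A := (true, 0).
have wi n : (n < size w)%N -> nth d w n \in w by apply: mem_nth.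
rewrite (big_nth d) .
apply: (xy_free (i := fun n => (nth d w n).1)).
- by rewrite lt0n size_eq0.
- by move=> n /wi /cw [].
- by move=> n /wi /cw [].
- move=> n nw; apply/eqP.
  have -> : (nth d w n).1 = nth true (rcons (unzip1 w) i) n.
    by rewrite nth_rcons size_map ltnW // (nth_map d) // ltnW.
  have -> : (nth d w n.+1).1 = nth true (rcons (unzip1 w) i) n.+1.
    by rewrite nth_rcons size_map nw // (nth_map d).
  move: sw; case: (rcons (unzip1 w) i) (size_rcons (unzip1 w) i) => // j s.
  rewrite size_map => -[ss] /= /(pathP true) /(_ n); apply.
  by rewrite ss ltnW.
Qed.

(** The space in which the coefficients of Q live: it contains the centered
    elements of index [i], and left multiplication by one of them maps the space
    of the other index into it. *)
Definition orthogonal i c :=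
  forall w, alternating i w -> phi (\prod_(u <- w) u.2 * c) = 0.

Lemma alternating_nil i : alternating i [::]. Proof. by split. Qed.

Lemma orthogonal_phi i c : orthogonal i c -> phi c = 0.
Proof. by move/(_ _ (alternating_nil i)); rewrite big_nil mul1r. Qed.

Lemma orthogonal_centered i c : centered i c -> orthogonal i c.
Proof.
move=> ci w /alternating_rcons /(_ ci) /alternating_phi.
by rewrite -cats1 big_cat big_seq1 => -> //; case: w.
Qed.

Lemma orthogonalM i c d : centered i c -> orthogonal (~~ i) d ->
  orthogonal i (c * d).
Proof.
move=> ci od w /alternating_rcons /(_ ci) /od.
by rewrite -cats1 big_cat big_seq1 mulrA.
Qed.

Lemma orthogonalP i k c d : orthogonal i c -> orthogonal i d ->
  orthogonal i (k *: c + d).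
Proof.
move=> oc od w aw; rewrite mulrDr -scalerAr linearP oc // od //.
by rewrite /= mulr0 addr0.
Qed.

Lemma orthogonal0 i : orthogonal i 0.
Proof. by move=> w _; rewrite mulr0 linear0. Qed.

Lemma orthogonalD i c d : orthogonal i c -> orthogonal i d ->
  orthogonal i (c + d).
Proof. by move=> oc od; rewrite -[c]scale1r; apply: orthogonalP. Qed.

Lemma orthogonalZ i k c : orthogonal i c -> orthogonal i (k *: c).
Proof.
by move=> oc; rewrite -[_ *: _]addr0; apply: orthogonalP oc _; apply: orthogonal0.
Qed.

Lemma orthogonal_sum i n (P : pred 'I_n) (F : 'I_n -> A) :
  (forall k, P k -> orthogonal i (F k)) -> orthogonal i (\sum_(k | P k) F k).
Proof.
move=> oF; elim/big_ind: _ => //; first exact: orthogonal0.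
by move=> c d; apply: orthogonalD.
Qed.

Lemma centered_geo i (t z : fps R[i]) :
  fps_phi phi (fps_geo (t *: fpsC (if i then x else y))) = 1 + z ->
  forall n, centered i
    ((fps_geo (t *: fpsC (if i then x else y)) - (1 + z)%:A) n).
Proof.
move=> e n; split; last first.
  rewrite fpsB linearB /=; have := congr1 (@^~ n) e; rewrite {1}/fps_phi => ->.
  have := congr1 (@^~ n) (fps_phiZ phi (1 + z) 1).
  by rewrite {1}/fps_phi fps_phi1 // mulr1 => ->; rewrite subrr.
rewrite fpsB (_ : ((1 + z)%:A : fps A) n = (1 + z) n *: 1); last first.
  exact: (@fpsZC _ A).
rewrite addrC -scaleNr; apply: generatedP; first exact: generated1.
rewrite fps_geoZC; elim/big_ind: _ => [||k _]; first exact: generated0.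
  by move=> ? ?; apply: generatedD.
by apply: generatedZ; apply: generatedX; apply: generated_incl.
Qed.

End Freeness.

Section FreeMultiplicative.
Variables (R : realType) (A : algType R[i]) (phi : {scalar A}) (x y : A).
Hypothesis phi1 : phi 1 = 1.
Hypothesis xy_free : free_pair phi x y.

(** Multiplicativity of the S-transform: solving M_a(u) = 1 + z for u and
    M_b(v) = 1 + z for v as series in z, the hypothesis on [t] reads
    S_ab = S_a S_b.  Leaving the parameter free avoids these inversions. *)
Lemma moment_series_free_mul (u v z t : fps R[i]) :
  u 0 = 0 -> v 0 = 0 -> z 0 = 0 -> t 0 = 0 -> z 1 != 0 ->
  fps_comp (moment_series phi x) u = 1 + z ->
  fps_comp (moment_series phi y) v = 1 + z ->
  u * v * (1 + z) = z * t ->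
  fps_comp (moment_series phi (x * y)) t = 1 + z.
Proof.
move=> u0 v0 z0 t0 z1; rewrite -!fps_phi_geo => Ex Ey Et.
have g0 (c : fps R[i]) (a : A) : c 0 = 0 -> (c *: fpsC a) 0 = 0.
  by move=> c0; rewrite fpsZC c0 scale0r.
set X := fps_geo (u *: fpsC x) in Ex.
set Y := fps_geo (v *: fpsC y) in Ey.
set T := fps_geo _.
pose X0 : fps A := X - (1 + z)%:A; pose Y0 : fps A := Y - (1 + z)%:A.
have cX : forall n, centered phi x y true (X0 n).
  exact: (@centered_geo _ _ _ x y phi1 true).
have cY : forall n, centered phi x y false (Y0 n).
  exact: (@centered_geo _ _ _ x y phi1 false).
pose Q : fps A := (1 - v *: fpsC y) * T - 1.
have TE : T = Y * (1 + Q).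
  by rewrite addrC subrK mulrA fps_geoVl ?mul1r // g0.
have XE : X = X0 + (1 + z)%:A by rewrite subrK.
have YE : Y = Y0 + (1 + z)%:A by rewrite subrK.
have shift0 (c : fps R[i]) (a : A) : c 0 = 0 ->
    (fps_geo (c *: fpsC a) - (1 + z)%:A : fps A) 0 = 0.
  move=> c0; rewrite fpsB fps_geoZC big_ord1 !expr0 fps1 scale1r.
  rewrite (_ : ((1 + z)%:A : fps A) 0 = (1 + z) 0 *: 1).
    by rewrite fpsD z0 addr0 fps1 scale1r subrr.
  exact: (@fpsZC _ A).
have X00 : X0 0 = 0 by apply: shift0.
have Y00 : Y0 0 = 0 by apply: shift0.
clearbody X0 Y0 Q.
(* z (1 - t xy) = X^-1 (z (1 + z) - X0 Y0) Y^-1, multiplied by X on the left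
   and applied to T = Y (1 + Q) *)
have key : (z * (1 + z)) *: Q = z *: X0 + X0 * Y0 + X0 * Y0 * Q.
  have e1 : z *: (X * (T - 1)) = (1 + z) *: ((X - 1) * (Y - 1) * (1 + Q)).
    rewrite -(fps_geoMr (g0 _ _ t0)) -(fps_geoMl (g0 _ _ u0)).
    rewrite -(fps_geoMr (g0 _ _ v0)) -/X -/Y -/T.
    rewrite [in RHS]mulrA -[in RHS](mulrA _ Y) -TE fpsC_mul.
    rewrite -!(scalerAl, scalerAr) !scalerA -Et !mulrA.
    by congr (_ *: _); ring.
  have e2 : z *: (X * Y) - (1 + z) *: ((X - 1) * (Y - 1)) =
      (z * (1 + z))%:A - X0 * Y0.
    have -> : X - 1 = X0 + z%:A.
      by rewrite XE scalerDl scale1r addrA addrAC addrK.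
    have -> : Y - 1 = Y0 + z%:A.
      by rewrite YE scalerDl scale1r addrA addrAC addrK.
    rewrite XE YE; move: X0 Y0 {cX cY XE YE X00 Y00 TE} => P S.
    have e c : (P + c%:A) * (S + c%:A) =
        P * S + c *: P + c *: S + (c * c)%:A.
      rewrite mulrDl !mulrDr -!(scalerAl, scalerAr) mul1r !mulr1 scalerA.
      by rewrite addrA.
    have sub4 (a b c d a' b' c' d' : fps A) :
        a + b + c + d - (a' + b' + c' + d') =
        (a - a') + (b - b') + (c - c') + (d - d').
      by rewrite !opprD addrACA [a + b + c + _]addrACA [a + b + _]addrACA.
    rewrite !e !scalerDr !scalerA sub4 -!scalerBl.
    rewrite [RHS]addrC -scaleN1r; congr (_ + _); last by congr (_ *: _); ring.
    rewrite -[RHS]addr0 -[RHS]addr0; congr (_ + _ + _).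
    - by congr (_ *: _); ring.
    - by rewrite -[RHS](scale0r P); congr (_ *: _); ring.
    - by rewrite -[RHS](scale0r S); congr (_ *: _); ring.
  have e3 : (z * (1 + z))%:A * (1 + Q) - X0 * Y0 * (1 + Q) = z *: X.
    rewrite -mulrBl -e2 mulrBl -!scalerAl -e1 TE mulrBr mulr1 scalerBr mulrA.
    by rewrite subKr.
  move/(congr1 (+%R^~ (X0 * Y0 * (1 + Q)))): e3.
  rewrite subrK -scalerAl mul1r scalerDr XE scalerDr scalerA.
  rewrite [X0 * Y0 * _]mulrDr mulr1.
  move=> e3; apply: (addrI (z * (1 + z))%:A).
  by rewrite e3 -[in RHS]addrA [RHS]addrA [_ + z *: X0]addrC.
(* In degree n + 1, [key] reads z_1 Q_n = terms in Q_m with m < n, because z,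
   X0 and Y0 have no constant term. *)
have oQ n : orthogonal phi x y true (Q n).
  elim/ltn_ind: n => n IH.
  have zo0 : (z * (1 + z)) 0 = 0 by rewrite fpsM big_ord1 z0 mul0r.
  have zo1 : (z * (1 + z)) 1 = z 1.
    rewrite fpsM big_ord_recl z0 mul0r add0r big_ord1 fpsD fps1 z0.
    by rewrite addr0 mulr1.
  have := congr1 (@^~ n.+1) key; rewrite {1}fpsZ big_ord_recl zo0 scale0r add0r.
  rewrite big_ord_recl zo1 subn1 /= => /(canRL (addrK _)) e.
  rewrite -[Q n]scale1r -(mulVf z1) -scalerA; apply: orthogonalZ.
  rewrite e -scaleN1r; apply: orthogonalD; last first.
    apply: orthogonalZ; apply: orthogonal_sum => i _; apply: orthogonalZ.
    by apply: IH; have := ltn_ord i; rewrite /bump /=; lia.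
  rewrite !fpsD; apply: orthogonalD; first apply: orthogonalD.
  - rewrite fpsZ; apply: orthogonal_sum => i _; apply: orthogonalZ.
    by apply: (orthogonal_centered xy_free).
  - rewrite fpsM; apply: orthogonal_sum => i _.
    refine (orthogonalM (i := true) (cX _) _).
    exact: (@orthogonal_centered _ _ _ x y xy_free false).
  - rewrite -mulrA fpsM; apply: orthogonal_sum => i _.
    have [->|i0] := eqVneq (val i) 0.
      by rewrite X00 mul0r; apply: orthogonal0.
    refine (orthogonalM (i := true) (cX _) _).
    rewrite fpsM; apply: orthogonal_sum => j _.
    have [->|j0] := eqVneq (val j) 0.
      by rewrite Y00 mul0r; apply: orthogonal0.
    refine (orthogonalM (i := false) (cY _) _); apply: IH.
    have ip : (0 < i)%N by rewrite lt0n.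
    have jp : (0 < j)%N by rewrite lt0n.
    have := ltn_ord i; have := ltn_ord j; lia.
rewrite TE mulrDr mulr1 YE mulrDl fps_phiD -YE Ey fps_phiD.
have -> : fps_phi phi (Y0 * Q) = 0.
  apply: funext => n; rewrite /fps_phi fpsM linear_sum big1 // => i _.
  apply: (@orthogonal_phi _ _ _ x y false).
  exact: (orthogonalM (i := false) (cY _) (oQ _)).
rewrite -scalerAl mul1r fps_phiZ (_ : fps_phi phi Q = 0) ?mulr0 ?addr0 //.
by apply: funext => n; apply: (@orthogonal_phi _ _ _ x y true).
Qed.
End FreeMultiplicative.

(** * Counting non-crossing partitions by blocks *)

(** The base set is an arbitrary subset of a fixed ordinal type, so that cutting
    a partition into pieces needs no renumbering. *)
Definition nc_partition n (S : {set 'I_n}) (P : {set {set 'I_n}}) : bool :=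
  finset.partition P S &&
  [forall V in P, forall W in P, (V != W) ==> ~~ crossing V W].

Lemma crossingP n (V W : {set 'I_n}) :
  reflect (exists a b c d : 'I_n, [/\ (a < b)%N, (b < c)%N, (c < d)%N,
             a \in V /\ c \in V & b \in W /\ d \in W])
          (crossing V W).
Proof.
apply: (iffP existsP) => -[a].
  move=> /existsP[b /existsP[c /existsP[d /and5P[? ? ? ? /and3P[? ? ?]]]]].
  by exists a, b, c, d.
move=> [b [c [d [ab bc cd [aV cV] [bW dW]]]]]; exists a; apply/existsP.
exists b; apply/existsP; exists c; apply/existsP; exists d.
by rewrite ab bc cd aV cV bW.
Qed.

Lemma nc_partitionP n (S : {set 'I_n}) (P : {set {set 'I_n}}) :
  reflect [/\ forall V, V \in P -> exists x, x \in V,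
              forall V x, V \in P -> x \in V -> x \in S,
              forall x, x \in S -> exists2 V, V \in P & x \in V,
              forall V W x, V \in P -> W \in P -> x \in V -> x \in W -> V = W
            & forall V W, V \in P -> W \in P -> V <> W -> ~ crossing V W]
          (nc_partition S P).
Proof.
apply: (iffP andP) => [[/and3P[/eqP cP /finset.trivIsetP tP P0] nc]|].
  split.
  - by move=> V VP; apply/set0Pn; apply: contraNneq P0 => <-.
  - by move=> V x VP xV; rewrite -cP; apply/bigcupP; exists V.
  - by move=> x; rewrite -cP => /bigcupP[V VP xV]; exists V.
  - move=> V W x VP WP xV xW; apply/eqP; apply: contraT => /(tP _ _ VP WP).
    by move/pred0P/(_ x); rewrite /= xV xW.
  - move=> V W VP WP /eqP VW; apply/negP.
    move: nc => /'forall_implyP/(_ V VP)/'forall_implyP/(_ W WP)/implyP.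
    exact.
move=> [ne sub cov uni nc]; split.
  apply/and3P; split.
  - apply/eqP/setP => x; apply/bigcupP/idP => [[V VP xV]|/cov[V VP xV]].
      exact: sub VP xV.
    by exists V.
  - apply/finset.trivIsetP => V W VP WP VW; apply/pred0P => x /=.
    by apply/negbTE; apply: contra VW => /andP[xV xW]; rewrite (uni V W x).
  - by apply/negP => /ne[x]; rewrite inE.
apply/'forall_implyP => V VP; apply/'forall_implyP => W WP.
by apply/implyP => /eqP VW; apply/negP; apply: nc.
Qed.

Section FirstElement.
Variables (n : nat) (S : {set 'I_n}) (a : 'I_n).
Hypothesis aS : a \in S.
Hypothesis a_min : forall x, x \in S -> x != a -> (a < x)%N.
Implicit Types (P Q : {set {set 'I_n}}) (V W : {set 'I_n}).

Let S' := S :\ a.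

Section Next.
Variable j : 'I_n.
Hypothesis jS' : j \in S'.

Let X := [set x in S' | (x < j)%N].
Let Y := [set x in S' | (j <= x)%N].

Definition second_in_block P := [exists V in P,
  [&& a \in V, j \in V & [forall x in V, (x == a) || (j <= x)%N]]].

(** Given partitions of the points before [j] and of those from [j] on, adjoin
    [a] to the block of [j]; [unglue] is the inverse operation. *)
Let insert V := if j \in V then a |: V else V.

Let glue (p : {set {set 'I_n}} * {set {set 'I_n}}) : {set {set 'I_n}} :=
  p.1 :|: [set insert V | V in p.2].

Let unglue P : {set {set 'I_n}} * {set {set 'I_n}} :=
  ([set V in P | V \subset X], [set V :\ a | V in P & ~~ (V \subset X)]).

Let aj : (a < j)%N.
Proof. by move: jS'; rewrite !inE => /andP[ja jS]; apply: a_min. Qed.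

Let XP x : (x \in X) = [&& x \in S, (a < x)%N & (x < j)%N].
Proof.
rewrite !inE; have [->|xa] := eqVneq x a; first by rewrite ltnn andbF.
by have [xS|//] := boolP (x \in S); rewrite a_min.
Qed.

Let YP x : (x \in Y) = (x \in S) && (j <= x)%N.
Proof.
rewrite !inE; have [->|xa //] := eqVneq x a.
by rewrite [in RHS]leqNgt aj andbF.
Qed.

(** A block meeting both sides of [j] would cross the block of [a] and [j]. *)
Let blockXY P V : nc_partition S P -> second_in_block P -> V \in P ->
  ~~ (V \subset X) -> forall x, x \in V -> x = a \/ x \in Y.
Proof.
move=> /nc_partitionP[ne sub cov uni nc] /'exists_andP[V0 [V0P]].
move=> /and3P[aV0 jV0 /'forall_implyP V0X] VP /subsetPn[y yV yX] x xV.
have [-> //|xa] := eqVneq x a; [by left|right].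
rewrite YP (sub _ _ VP xV) /= leqNgt; apply/negP => xj.
have [VV0|VV0] := eqVneq V V0.
  by have := V0X x; rewrite -VV0 xV (negbTE xa) /= leqNgt xj => /(_ isT).
have yV0 z : z \in V -> z \in V0 -> False.
  by move=> zV zV0; case/eqP: VV0; apply: uni zV zV0.
have ax : (a < x)%N by apply: a_min xa; apply: sub xV.
have ya : y != a by apply/eqP => ya; apply: (yV0 y); rewrite // ya.
have ay : (a < y)%N by apply: a_min ya; apply: sub yV.
have jy : (j < y)%N.
  move: yX; rewrite XP (sub _ _ VP yV) ay /= -leqNgt leq_eqVlt.
  case/orP => // /eqP/val_inj jy; case: (yV0 y) => //; by rewrite -jy.
apply: (nc V0 V V0P VP); first by apply/eqP; rewrite eq_sym.
by apply/crossingP; exists a, x, j, y.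
Qed.

Let glueK P : nc_partition S P -> second_in_block P -> glue (unglue P) = P.
Proof.
move=> ncP nP; have bXY := blockXY ncP nP.
have [ne sub cov uni nc] := nc_partitionP _ _ ncP.
have [V0 [V0P /and3P[aV0 jV0 _]]] := 'exists_andP nP.
have insK V : V \in P -> ~~ (V \subset X) -> insert (V :\ a) = V.
  move=> VP VX; rewrite /insert !inE.
  have -> : (j != a) by apply/eqP => ja; move: aj; rewrite ja ltnn.
  have [VV0|VV0] := eqVneq V V0; first by rewrite VV0 jV0 finset.setD1K.
  have no z : z \in V0 -> z \notin V.
    by move=> zV0; apply: contra VV0 => zV; apply/eqP; apply: uni zV zV0.
  rewrite (negbTE (no _ jV0)) /=.
  apply/setP => z; rewrite !inE; have [->|//] := eqVneq z a.
  by rewrite (negbTE (no _ aV0)).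
apply/setP => V; apply/idP/idP.
  case/setUP; first by rewrite inE => /andP[].
  case/imsetP => W /imsetP[U]; rewrite inE => /andP[UP UX] -> ->.
  by rewrite insK.
move=> VP; apply/setUP; have [VX|VX] := boolP (V \subset X).
  by left; rewrite inE VP.
right; apply/imsetP; exists (V :\ a); last by rewrite insK.
by apply/imsetP; exists V => //; rewrite inE VP.
Qed.

Let unglue_nc P : nc_partition S P -> second_in_block P ->
  nc_partition X (unglue P).1 && nc_partition Y (unglue P).2.
Proof.
move=> ncP nP; have bXY := blockXY ncP nP.
have [ne sub cov uni nc] := nc_partitionP _ _ ncP.
have [V0 [V0P /and3P[aV0 jV0 _]]] := 'exists_andP nP.
apply/andP; split; apply/nc_partitionP; split.
- by move=> V; rewrite inE => /andP[/ne].
- by move=> V x; rewrite inE => /andP[_ /fintype.subsetP]; apply.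
- move=> x xX; have := xX; rewrite XP => /and3P[xS ax xj].
  have [V VP xV] := cov _ xS; exists V => //; rewrite inE VP /=.
  apply/negPn/negP => /(bXY _ VP)/(_ _ xV)[xa|].
    by move: ax; rewrite xa ltnn.
  by rewrite YP leqNgt xj andbF.
- by move=> V W x; rewrite !inE => /andP[VP _] /andP[WP _]; apply: uni.
- by move=> V W; rewrite !inE => /andP[VP _] /andP[WP _]; apply: nc.
- move=> ? /imsetP[V]; rewrite inE => /andP[VP VX] ->.
  have [xV|xV] := boolP [exists x in V, x != a].
    by have /'exists_andP[x [xV' xa]] := xV; exists x; rewrite !inE xa.
  have [z zV] := ne _ VP.
  have za : z = a.
    by apply/eqP; apply: contraNT xV => za; apply/'exists_andP; exists z.
  have VV0 : V = V0 by apply: (uni _ _ a) => //; rewrite -za.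
  exists j; rewrite VV0 !inE jV0 andbT.
  by apply/eqP => ja; move: aj; rewrite ja ltnn.
- move=> ? x /imsetP[V]; rewrite inE => /andP[VP VX] ->.
  by case/setD1P => /eqP xa /(bXY _ VP VX _)[].
- move=> x; rewrite YP => /andP[xS jx]; have [V VP xV] := cov _ xS.
  exists (V :\ a).
    apply/imsetP; exists V => //; rewrite inE VP; apply/subsetPn; exists x => //.
    by rewrite XP [(x < j)%N]ltnNge jx !andbF.
  rewrite !inE xV andbT; apply/eqP => xa; move: aj.
  by rewrite -xa ltnNge jx.
- move=> ? ? x /imsetP[V]; rewrite inE => /andP[VP VX] ->.
  move=> /imsetP[W]; rewrite inE => /andP[WP WX] ->.
  by rewrite !inE => /andP[_ xV] /andP[_ xW]; rewrite (uni V W x).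
- move=> ? ? /imsetP[V]; rewrite inE => /andP[VP VX] ->.
  move=> /imsetP[W]; rewrite inE => /andP[WP WX] -> VW.
  move=> /crossingP[p [q [r [s [pq qr rs]]]]].
  rewrite !inE => -[/andP[_ pV] /andP[_ rV]] [/andP[_ qW] /andP[_ sW]].
  apply: (nc V W VP WP); first by move=> e; rewrite e in VW.
  by apply/crossingP; exists p, q, r, s.
Qed.

Section Glue.
Variables P1 P2 : {set {set 'I_n}}.
Hypothesis nc1 : nc_partition X P1.
Hypothesis nc2 : nc_partition Y P2.

Let insert_nX V : V \in P2 -> ~~ (insert V \subset X).
Proof.
move=> VP; have [ne sub _ _ _] := nc_partitionP _ _ nc2.
have [x xV] := ne _ VP; apply/subsetPn; exists x.
  by rewrite /insert; case: ifP => //; rewrite !inE xV orbT.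
have := sub _ _ VP xV; rewrite YP XP => /andP[_].
by rewrite leqNgt => /negbTE ->; rewrite !andbF.
Qed.

Let insertK V : V \in P2 -> insert V :\ a = V.
Proof.
move=> VP; have [ne sub _ _ _] := nc_partitionP _ _ nc2.
have aV : a \notin V.
  apply/negP => /(sub _ _ VP); rewrite YP => /andP[_].
  by rewrite leqNgt aj.
rewrite /insert; case: ifP => _; first by rewrite finset.setU1K.
by apply/setP => x; rewrite !inE; case: eqVneq => // ->; rewrite (negbTE aV).
Qed.

Let insert_inj : {in P2 &, injective insert}.
Proof. by move=> V W VP WP e; rewrite -(insertK VP) -(insertK WP) e. Qed.

Let sub1 V : V \in P1 -> V \subset X.
Proof.
have [_ sub _ _ _] := nc_partitionP _ _ nc1.
by move=> VP; apply/fintype.subsetP => x; apply: sub.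
Qed.

Let unglueK : unglue (glue (P1, P2)) = (P1, P2).
Proof.
rewrite /unglue /glue /=; congr pair; apply/setP => V; rewrite ?inE.
  apply/andP/idP => [[/orP[//|/imsetP[W WP ->]]]|VP].
    by rewrite (negbTE (insert_nX WP)).
  by rewrite VP sub1.
apply/imsetP/idP => [[U]|VP].
  rewrite !inE => /andP[/orP[/sub1 ->//|/imsetP[W WP ->]] _ ->].
  by rewrite insertK.
exists (insert V); last by rewrite insertK.
by rewrite !inE imset_f ?orbT ?insert_nX.
Qed.

Let card_glue : #|glue (P1, P2)| = (#|P1| + #|P2|)%N.
Proof.
rewrite /glue cardsU (_ : P1 :&: _ = finset.set0).
  by rewrite cards0 subn0 card_in_imset.
apply/setP => V; rewrite !inE; apply/negP => /andP[/sub1 VX /imsetP[W WP e]].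
by move: (insert_nX WP); rewrite -e VX.
Qed.

Let glue_nc : nc_partition S (glue (P1, P2)) && second_in_block (glue (P1, P2)).
Proof.
have [ne1 su1 cov1 uni1 ncr1] := nc_partitionP _ _ nc1.
have [ne2 su2 cov2 uni2 ncr2] := nc_partitionP _ _ nc2.
have jY : j \in Y by rewrite YP leqnn andbT; move: jS'; rewrite inE => /andP[].
have [B BP jB] := cov2 _ jY.
have mem_insert V x : V \in P2 -> x \in insert V ->
    x \in V \/ (x = a /\ V = B).
  move=> VP; rewrite /insert; case: ifP => [jV|_]; last by left.
  rewrite !inE => /orP[/eqP ->|]; last by left.
  by right; split => //; apply: uni2 jV jB.
have ins_ge V x : V \in P2 -> x \in insert V -> x = a \/ (j <= x)%N.
  move=> VP /(mem_insert _ _ VP)[xV|[->]]; last by left.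
  by right; have := su2 _ _ VP xV; rewrite YP => /andP[].
have P1_lt V x : V \in P1 -> x \in V -> (a < x < j)%N.
  by move=> VP /(su1 _ _ VP); rewrite XP => /and3P[_ -> ->].
have sub_insert V : V \subset insert V.
  by rewrite /insert; case: ifP => // _; apply: finset.subsetUr.
apply/andP; split; last first.
  apply/'exists_andP; exists (insert B); split.
    by apply/setUP; right; apply: imset_f.
  apply/and3P; split.
  - by rewrite /insert jB setU11.
  - exact: (fintype.subsetP (sub_insert _)).
  apply/'forall_implyP => x /(ins_ge _ _ BP)[->|->]; rewrite ?eqxx ?orbT //.
apply/nc_partitionP; split.
- move=> V /setUP[/ne1 //|/imsetP[W WP ->]]; have [x xW] := ne2 _ WP.
  by exists x; apply: (fintype.subsetP (sub_insert _)).
- move=> V x /setUP[VP /(su1 _ _ VP)|/imsetP[W WP ->]].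
    by rewrite XP => /and3P[].
  move=> /(mem_insert _ _ WP)[/(su2 _ _ WP)|[-> _] //].
  by rewrite YP => /andP[].
- move=> x xS; have [->|xa] := eqVneq x a.
    exists (insert B); first by apply/setUP; right; apply: imset_f.
    by rewrite /insert jB setU11.
  have ax := a_min xS xa; have [jx|xj] := leqP j x.
    have /cov2[V VP xV] : x \in Y by rewrite YP xS.
    exists (insert V); first by apply/setUP; right; apply: imset_f.
    exact: (fintype.subsetP (sub_insert _)).
  have /cov1[V VP xV] : x \in X by rewrite XP xS ax.
  by exists V => //; apply/setUP; left.
- have mixed V W x : V \in P1 -> W \in P2 -> x \in V -> x \in insert W -> False.
    move=> VP WP /(P1_lt _ _ VP) /andP[ax xj] /(ins_ge _ _ WP)[xa|jx].
      by rewrite xa ltnn in ax.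
    by rewrite ltnNge jx in xj.
  move=> V W x /setUP[VP|/imsetP[V' VP ->]] /setUP[WP|/imsetP[W' WP ->]] xV xW.
  + exact: uni1 xV xW.
  + by case: (mixed V W' x).
  + by case: (mixed W V' x).
  + congr insert.
    have [xV'|[xa ->]] := mem_insert _ _ VP xV;
      have [xW'|[xa' ->]] := mem_insert _ _ WP xW => //.
    * exact: uni2 xV' xW'.
    * by have := su2 _ _ VP xV'; rewrite xa' YP leqNgt aj andbF.
    * by have := su2 _ _ WP xW'; rewrite xa YP leqNgt aj andbF.
- have betw V (p q r : 'I_n) : V \in P1 -> (p < q)%N -> (q < r)%N ->
      p \in V -> r \in V -> forall W, W \in P2 -> q \in insert W -> False.
    move=> VP pq qr /(P1_lt _ _ VP) /andP[ap _] /(P1_lt _ _ VP) /andP[_ rj].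
    move=> W WP /(ins_ge _ _ WP)[qa|jq].
      by move: (ltn_trans ap pq); rewrite qa ltnn.
    by move: (ltn_trans qr rj); rewrite ltnNge jq.
  move=> V W /setUP[VP|/imsetP[V' VP ->]] /setUP[WP|/imsetP[W' WP ->]] VW.
  + exact: ncr1.
  + move=> /crossingP[p [q [r [s [pq qr rs [pV rV] [qW sW]]]]]].
    exact: (betw V p q r VP pq qr pV rV _ WP qW).
  + move=> /crossingP[p [q [r [s [pq qr rs [pV rV] [qW sW]]]]]].
    exact: (betw W q r s WP qr rs qW sW _ VP rV).
  + move=> /crossingP[p [q [r [s [pq qr rs [pV rV] [qW sW]]]]]].
    have VW' : V' <> W' by move=> e; rewrite e in VW.
    have aq : (a < q)%N.
      have [qW'|[qa WB]] := mem_insert _ _ WP qW.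
        apply: leq_trans aj _; have := su2 _ _ WP qW'.
        by rewrite YP => /andP[].
      have [pa|jp] := ins_ge _ _ VP pV; first by rewrite qa pa ltnn in pq.
      by move: (leq_ltn_trans jp pq); rewrite qa ltnNge (ltnW aj).
    have inV (x : 'I_n) : (a < x)%N -> x \in insert V' -> x \in V'.
      move=> ax /(mem_insert _ _ VP)[//|[xa _]].
      by rewrite xa ltnn in ax.
    have inW (x : 'I_n) : (a < x)%N -> x \in insert W' -> x \in W'.
      move=> ax /(mem_insert _ _ WP)[//|[xa _]].
      by rewrite xa ltnn in ax.
    have ar := ltn_trans aq qr; have as_ := ltn_trans ar rs.
    have {}qW := inW _ aq qW; have {}sW := inW _ as_ sW.
    have {}rV := inV _ ar rV.
    apply: (ncr2 V' W' VP WP VW'); apply/crossingP.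
    have [pV'|[pa VB]] := mem_insert _ _ VP pV; first by exists p, q, r, s.
    (* [a] starts the crossing; [j], in the same block, can replace it *)
    exists j, q, r, s; split => //; last by split => //; rewrite VB.
    have : (j <= q)%N by have := su2 _ _ WP qW; rewrite YP => /andP[].
    rewrite leq_eqVlt => /orP[/eqP/val_inj jq|//].
    by case: VW'; rewrite VB; apply: uni2 jB _ => //; rewrite jq.
Qed.

Lemma glueP : [/\ nc_partition S (glue (P1, P2)), second_in_block (glue (P1, P2)),
  unglue (glue (P1, P2)) = (P1, P2) & #|glue (P1, P2)| = (#|P1| + #|P2|)%N].
Proof. by split; rewrite ?unglueK ?card_glue //; case/andP: glue_nc. Qed.

End Glue.

(** A partition in which [j] follows [a] is a pair of independent partitions of
    the points before [j] and of the points from [j] on, and the numbers of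
    blocks add up. *)
Lemma sum_second_in_block (K : comNzRingType) (lam : K) :
  \sum_(P | nc_partition S P && second_in_block P) lam ^+ #|P| =
  (\sum_(P | nc_partition X P) lam ^+ #|P|) *
  (\sum_(P | nc_partition Y P) lam ^+ #|P|).
Proof.
rewrite (reindex_onto glue unglue) => [|P /andP[]]; last exact: glueK.
rewrite big_distrlr pair_big /=; apply: eq_big => [[P1 P2]|[P1 P2]] /=.
  apply/idP/idP => [/andP[/andP[ncP nP] /eqP e]|/andP[nc1 nc2]].
    by have := unglue_nc ncP nP; rewrite e.
  by have [-> -> -> _] := glueP nc1 nc2; rewrite eqxx.
move=> /andP[/andP[ncP nP] /eqP e].
have := unglue_nc ncP nP; rewrite e /= => /andP[nc1 nc2].
by have [_ _ _ ->] := glueP nc1 nc2; rewrite exprD.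
Qed.

End Next.

Lemma nc_partition_setD1 P : [set a] \notin P ->
  nc_partition S ([set a] |: P) = nc_partition S' P.
Proof.
move=> aP; apply/nc_partitionP/nc_partitionP => -[ne sub cov uni nc]; split.
- by move=> V VP; apply: ne; apply: setU1r.
- move=> V x VP xV; rewrite !inE (sub V) ?setU1r // andbT.
  apply/eqP => xa; move: aP; rewrite (uni [set a] V a) ?setU11 ?setU1r ?set11 //.
    by rewrite VP.
  by rewrite -xa.
- move=> x /setD1P[xa /cov[V /setU1P[->|VP] xV]]; last by exists V.
  by move: xV; rewrite inE (negbTE xa).
- by move=> V W x VP WP; apply: uni; apply: setU1r.
- by move=> V W VP WP; apply: nc; apply: setU1r.
- by move=> V /setU1P[->|/ne //]; exists a; rewrite set11.
- move=> V x /setU1P[->|VP xV]; first by move/set1P ->.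
  by have /setD1P[] := sub _ _ VP xV.
- move=> x xS; have [->|xa] := eqVneq x a.
    by exists [set a]; rewrite ?setU11 ?set11.
  by have [|V VP xV] := cov x; [apply/setD1P|exists V; rewrite ?setU1r].
- have aV V : V \in P -> a \notin V.
    by move=> VP; apply/negP => /(sub _ _ VP)/setD1P[/eqP].
  move=> V W x /setU1P[->|VP] /setU1P[->|WP] //.
  + by move=> /set1P -> aW; case/negP: (aV _ WP).
  + by move=> xV /set1P xa; case/negP: (aV _ VP); rewrite -xa.
  + exact: uni.
- have no (x y : 'I_n) : (x < y)%N -> x \in [set a] -> y \in [set a] -> False.
    by move=> xy /set1P xa /set1P ya; rewrite xa ya ltnn in xy.
  move=> V W /setU1P[->|VP] /setU1P[->|WP] VW //; last exact: nc.
  + move=> /crossingP[p [q [r [s [pq qr rs [pV rV] [qW sW]]]]]].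
    exact: (no _ _ (ltn_trans pq qr)).
  + move=> /crossingP[p [q [r [s [pq qr rs [pV rV] [qW sW]]]]]].
    exact: (no _ _ (ltn_trans qr rs)).
Qed.

Lemma sum_single (K : comNzRingType) (lam : K) :
  \sum_(P | nc_partition S P && ([set a] \in P)) lam ^+ #|P| =
  lam * \sum_(P | nc_partition S' P) lam ^+ #|P|.
Proof.
rewrite (reindex_onto (fun P => [set a] |: P) (fun P => P :\ [set a]));
  last first.
  by move=> P /andP[_ aP]; rewrite finset.setD1K.
rewrite big_distrr; apply: eq_big => P.
  rewrite setU11 andbT; have [aP|aP] := boolP ([set a] \in P).
    rewrite (_ : (_ == P) = false) ?andbF; last first.
      by apply/eqP => /setP /(_ [set a]); rewrite setD11 aP.
    apply/esym/negP => /nc_partitionP[_ sub _ _ _].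
    by have := sub _ a aP (set11 _); rewrite setD11.
  by rewrite nc_partition_setD1 // finset.setU1K // eqxx andbT.
move=> /andP[_ /eqP e]; rewrite cardsU1 -[in X in (X + _)%N]e setD11.
by rewrite exprS.
Qed.

(** The witness is the least element of the block of [a] other than [a]. *)
Lemma second_in_block_sum P : nc_partition S P -> forall (K : comNzRingType) (c : K),
  \sum_(j in S' | second_in_block j P) c = if [set a] \in P then 0 else c.
Proof.
move=> ncP K c; have [ne sub cov uni nc] := nc_partitionP _ _ ncP.
case: ifP => aP.
  rewrite big_pred0 // => j; apply/negP => /andP[/setD1P[/eqP ja _]].
  move=> /'exists_andP[V [VP /and3P[aV jV _]]].
  have : [set a] = V by apply: (uni _ _ a); rewrite ?set11.
  by move=> /setP/(_ j); rewrite jV => /set1P.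
have [V VP aV] := cov a aS.
have [x /andP[xV xa]] : exists x, (x \in V) && (x != a).
  apply/existsP; apply: contraFT aP => /existsPn no.
  rewrite (_ : [set a] = V) //; apply/setP => x; apply/set1P/idP => [-> //|xV].
  by apply/eqP; have := no x; rewrite xV negbK.
pose Q := fun x : 'I_n => (x \in V) && (x != a).
have Qx : Q x by rewrite /Q xV.
case: (arg_minnP (fun x : 'I_n => x : nat) Qx) => j /andP[jV ja] jmin.
rewrite (big_pred1 j) // => k; apply/andP/eqP => [[kS]|->].
  move=> /'exists_andP[W [WP /and3P[aW kW /'forall_implyP kmin]]].
  have VW : W = V by apply: (uni _ _ a).
  rewrite VW in kW kmin; apply/val_inj/eqP; rewrite eqn_leq jmin; last first.
    by rewrite /Q kW; move: kS => /setD1P[].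
  by have := kmin j jV; rewrite (negbTE ja) /= => ->.
split; first by rewrite !inE ja (sub V).
apply/'exists_andP; exists V; split => //; apply/and3P; split => //.
apply/'forall_implyP => y yV; have [//|ya /=] := eqVneq y a.
by apply: jmin; rewrite /Q yV.
Qed.

(** The recursion for the block-counting sums: either [a] is alone in its block,
    which contributes a factor [lam], or some [j] follows it. *)
Lemma sum_first (K : comNzRingType) (lam : K) :
  let F T := \sum_(P | nc_partition T P) lam ^+ #|P| in
  F S = lam * F S' +
    \sum_(j in S') F [set x in S' | (x < j)%N] * F [set x in S' | (j <= x)%N].
Proof.
rewrite /= (bigID (fun P => [set a] \in P)) /= sum_single; congr (_ + _).
under [RHS]eq_bigr => j jS' do rewrite -(sum_second_in_block jS').
rewrite (exchange_big_dep (nc_partition S)) /=; last by move=> j P _ /andP[].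
rewrite big_mkcondr /=; apply: eq_bigr => P ncP.
rewrite if_neg -(second_in_block_sum ncP).
by apply: eq_bigl => j; rewrite ncP.
Qed.

End FirstElement.

Section CountNoncrossing.
Variables (K : comNzRingType) (lam : K).

Definition interval n l m : {set 'I_n} := [set x : 'I_n | (l <= x < m)%N].

Let F n l m := \sum_(P | nc_partition (interval n l m) P) lam ^+ #|P|.

Let F_nil n l : F n l l = 1.
Proof.
rewrite /F (_ : interval n l l = finset.set0); last first.
  by apply/setP => x; rewrite !inE; lia.
rewrite (big_pred1 finset.set0) ?cards0 // => P.
rewrite /nc_partition finset.partition_set0 /=.
have [->|//] := eqVneq P finset.set0.
by apply/'forall_implyP => V; rewrite inE.
Qed.

Let F_rec n l d : (l + d.+1 <= n)%N ->
  F n l (l + d.+1) = lam * F n l.+1 (l.+1 + d) +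
    \sum_(i < d) F n l.+1 (l.+1 + i) * F n (l.+1 + i) (l.+1 + i + (d - i)).
Proof.
move=> ln; have ltln : (l < n)%N by lia.
pose a := Ordinal ltln; set S := interval n l (l + d.+1).
have aS : a \in S by rewrite inE /=; lia.
have a_min x : x \in S -> x != a -> (a < x)%N.
  rewrite inE => /andP[lx _] xa; rewrite ltn_neqAle lx andbT.
  by apply: contra xa => /eqP e; apply/eqP/val_inj.
have S'E : S :\ a = interval n l.+1 (l.+1 + d).
  by apply/setP => x; rewrite !inE -val_eqE /=; lia.
rewrite /F (sum_first aS a_min) S'E; congr (_ + _).
transitivity (\sum_(l.+1 <= j < l.+1 + d) F n l.+1 j * F n j (l.+1 + d)).
  rewrite big_geq_mkord (big_ord_widen_cond n (fun j => l.+1 <= j)%N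
    (fun j => F n l.+1 j * F n j (l.+1 + d))); last lia.
  apply: eq_big => [j|j]; first by rewrite inE.
  rewrite inE => /andP[lj jm]; congr (_ * _); apply: eq_bigl => P;
    by congr nc_partition; apply/setP => x; rewrite !inE; lia.
rewrite -{1}[l.+1]add0n big_addn addKn big_mkord; apply: eq_bigr => i _.
rewrite addnC; congr (_ * F _ _ _); have := ltn_ord i; lia.
Qed.

(** Intervals of the same length have the same sum, whatever the ambient ordinal
    type: both sides obey the same recursion. *)
Let F_shift n n' l l' d : (l + d <= n)%N -> (l' + d <= n')%N ->
  F n l (l + d) = F n' l' (l' + d).
Proof.
elim/ltn_ind: d n n' l l' => -[|d] IH n n' l l' ln ln'.
  by rewrite !addn0 !F_nil.
rewrite !F_rec // (IH d _ n n' l.+1 l'.+1) ?addSnnS //; congr (_ + _).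
apply: eq_bigr => i _; have := ltn_ord i => id.
rewrite (IH i _ n n' l.+1 l'.+1) 1?(IH (d - i)%N _ n n' _ (l'.+1 + i)%N) //;
  lia.
Qed.

Definition nc_poly n := \sum_(P : {set {set 'I_n}} | noncrossing P) lam ^+ #|P|.

Let F_poly n l d : (l + d <= n)%N -> F n l (l + d) = nc_poly d.
Proof.
move=> ln; rewrite (@F_shift n d l 0) //; apply: eq_bigl => P.
rewrite /noncrossing -/(nc_partition _ _); congr nc_partition.
by apply/setP => x; rewrite !inE ltn_ord.
Qed.

Lemma nc_poly0 : nc_poly 0 = 1.
Proof. by rewrite -(@F_poly 0 0 0) // F_nil. Qed.

Lemma nc_polyS d : nc_poly d.+1 =
  lam * nc_poly d + \sum_(i < d) nc_poly i * nc_poly (d - i).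
Proof.
rewrite -(@F_poly d.+1 0 d.+1) // F_rec // !F_poly //; congr (_ + _).
by apply: eq_bigr => i _; have := ltn_ord i => id; rewrite !F_poly //; lia.
Qed.

Lemma nc_sum_prod (al : K) n :
  \sum_(P : {set {set 'I_n}} | noncrossing P)
    \prod_(V in P) (lam * al ^+ #|V|) = al ^+ n * nc_poly n.
Proof.
rewrite big_distrr; apply: eq_bigr => P /andP[/finset.card_partition cP _] /=.
rewrite big_split prodr_const mulrC; congr (_ * _).
rewrite -(big_morph _ (exprD al) (expr0 al)).
by rewrite -cP cardsT card_ord.
Qed.

End CountNoncrossing.

(** * Free Poisson and Bernoulli moment series *)

Section PoissonSeries.
Variables (K : comNzRingType) (lam al : K).

(** The equation of the moment series 1 + z of a free Poisson variable of rate
    [lam] and jump size [al], at the point [t]: it is M = C(t M) for the cumulant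
    series C(s) = 1 + lam al s / (1 - al s), with denominators cleared. *)
Definition poisson_equation (t z : fps K) :=
  z = fpsC al * t * (1 + z) * (fpsC lam + z).

Definition poisson_series : fps K :=
  fun n => if n is 0 then 0 else al ^+ n * nc_poly lam n.

Lemma poisson_seriesP : poisson_equation fpsX poisson_series.
Proof.
apply: funext => n; rewrite -!mulrA fpsCM fpsXM; case: n => [|n] /=.
  by rewrite mulr0.
rewrite exprS -mulrA; congr (_ * _).
rewrite nc_polyS mulrDr [(1 + _) * _]mulrDr fpsD.
congr (_ + _).
  rewrite [(1 + _) * _]mulrC fpsCM fpsD fps1 mulrCA; congr (_ * _).
  by case: n => [|n] /=; rewrite ?nc_poly0 ?addr0 ?add0r ?mulr1.
rewrite fpsM big_ord_recr /= subnn mulr0 addr0 mulr_sumr.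
apply: eq_bigr => i _; have id := ltn_ord i.
case e : (n - i)%N => [|k]; first lia.
have -> : al ^+ n = al ^+ i * al ^+ (n - i) by rewrite -exprD subnKC // ltnW.
rewrite /= -e mulrACA; congr (_ * _).
rewrite fpsD fps1; case: (val i) => [|m] /=; last by rewrite add0r.
by rewrite addr0 nc_poly0 mulr1.
Qed.

Lemma poisson_equation_uniq t z z' : t 0 = 0 ->
  poisson_equation t z -> poisson_equation t z' -> z = z'.
Proof.
move=> t0 e e'; apply/eqP; rewrite -subr_eq0; apply/eqP.
apply: (@fps_contraction _ (fpsC al * t * (1 + fpsC lam + z + z'))).
  by rewrite -mulrA fpsCM fpsM big_ord1 t0 mul0r mulr0.
by rewrite {1}e {1}e'; ring.
Qed.

Lemma poisson_equation_comp t w : t 0 = 0 ->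
  poisson_equation fpsX w -> poisson_equation t (fps_comp w t).
Proof.
move=> t0 e; rewrite /poisson_equation {1}e !fps_compM // !fps_compD !fps_compC.
by rewrite fps_compX // -[1]/(fpsC 1) fps_compC.
Qed.

End PoissonSeries.

Section FreePoisson.
Variables (R : realType) (A : algType R[i]) (phi : {scalar A}).

Lemma moment_cumulant1 (x : A) n : (0 < n)%N ->
  phi (x ^+ n) = \sum_(P : {set {set 'I_n}} | noncrossing P)
    \prod_(V in P) free_cumulant1 phi #|V| x.
Proof.
move=> n0; have [_ /(_ (nseq n x))] := free_cumulantP phi.
rewrite size_nseq big_nseq => /(_ n0); rewrite -/(iter n ( *%R x) 1).
rewrite iter_mulr_1 => ->.
apply: eq_bigr => P _; apply: eq_bigr => V _; congr free_cumulant.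
apply: (@eq_from_nth _ 0); rewrite size_subword ?size_nseq // => i iV.
rewrite nth_nseq iV (nth_map (Ordinal n0)) -?cardE // nth_nseq.
by rewrite ltn_ord.
Qed.

Lemma free_poisson_moments (x : A) (lam al : R[i]) n :
  (forall m, (0 < m)%N -> free_cumulant1 phi m x = lam * al ^+ m) ->
  (0 < n)%N -> phi (x ^+ n) = al ^+ n * nc_poly lam n.
Proof.
move=> kx n0; rewrite moment_cumulant1 // -nc_sum_prod.
apply: eq_bigr => P /andP[/and3P[_ _ P0] _]; apply: eq_bigr => V VP.
by apply: kx; rewrite card_gt0; apply: contraNneq P0 => <-.
Qed.

(** The top block of the moment-cumulant formula isolates the n-th cumulant, so
    the moments determine the cumulants by induction. *)
Lemma free_poisson_cumulants (x : A) (lam al : R[i]) :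
  (forall n, (0 < n)%N -> phi (x ^+ n) = al ^+ n * nc_poly lam n) ->
  forall n, (0 < n)%N -> free_cumulant1 phi n x = lam * al ^+ n.
Proof.
move=> mx n; elim/ltn_ind: n => n IH n0.
have := mx n n0; rewrite moment_cumulant1 // -nc_sum_prod.
have ncT := noncrossing_setT n0.
rewrite (bigD1 _ ncT) [X in _ = X](bigD1 _ ncT) !big_set1 cardsT card_ord /=.
set S := (X in _ + X = _); set S' := (X in _ = _ + X).
suff -> : S = S' by move/addIr.
apply: eq_bigr => P /andP[ncP PT]; apply: eq_bigr => V VP.
apply: IH; first exact: noncrossing_card ncP PT VP.
rewrite card_gt0; apply: contraTneq VP => ->.
by case/andP: ncP => /and3P[].
Qed.

End FreePoisson.

(** f = 1 + p t / (1 - t), with the denominator cleared and no subtraction, so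
    that substitution needs additivity and multiplicativity only. *)
Definition bernoulli_equation (K : comNzRingType) (p : K) (t f : fps K) :=
  f + t = 1 + fpsC p * t + f * t.

Lemma bernoulli_equation_comp (K : comNzRingType) (p : K) (t f : fps K) :
  t 0 = 0 -> bernoulli_equation p fpsX f ->
  bernoulli_equation p t (fps_comp f t).
Proof.
move=> t0 /(congr1 (fun f => fps_comp f t)).
by rewrite !fps_compD !fps_compM // !fps_compX // !fps_compC fpsC1.
Qed.

(** * Recovering one factor from the law of the product *)

Section FreeFactors.
Variables (R : realType) (A : algType R[i]) (phi : {scalar A}) (a b : A).
Hypothesis phi1 : phi 1 = 1.
Hypothesis ab_free : free_pair phi a b.

Lemma free_pair_phiM : phi (a * b) = phi a * phi b.
Proof.
have c i : centered phi a b i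
    ((if i then a else b) - (phi (if i then a else b))%:A).
  split; last by rewrite linearB linearZ /= phi1 mulr1 subrr.
  rewrite addrC -scaleNr; apply: generatedP; first exact: generated1.
  exact: generated_incl.
have : phi ((a - (phi a)%:A) * (b - (phi b)%:A)) = 0.
  apply: (@orthogonal_phi _ _ phi a b true).
  apply: (orthogonalM (i := true) (c true)).
  exact: (orthogonal_centered ab_free (c false)).
rewrite mulrBl !mulrBr -!(scalerAl, scalerAr) mulr1 !mul1r.
rewrite !(linearB, linearZ) /= phi1 opprK /GRing.scale /= => e.
by apply/eqP; rewrite -subr_eq0 -[X in _ == X]e; apply/eqP; ring.
Qed.

Lemma bernoulli_moment_series x (p : R[i]) :
  (forall n, (0 < n)%N -> phi (x ^+ n) = p) ->
  bernoulli_equation p fpsX (moment_series phi x).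
Proof.
move=> mx; rewrite /bernoulli_equation.
rewrite [fpsC p * _]mulrC [moment_series _ _ * _]mulrC; apply: funext => n.
rewrite !fpsD !fpsXM fps1 /moment_series /fpsX.
case: n => [|[|n]] /=; first by rewrite expr0 phi1 !addr0.
  by rewrite expr0 phi1 mx // add0r.
by rewrite !mx // !addr0 !add0r.
Qed.

Lemma poisson_moment_series x (lam al : R[i]) :
  (forall n, (0 < n)%N -> free_cumulant1 phi n x = lam * al ^+ n) ->
  moment_series phi x = 1 + poisson_series lam al.
Proof.
move=> kx; apply: funext => n; rewrite fpsD fps1 /moment_series.
case: n => [|n] /=; first by rewrite addr0.
by rewrite add0r; apply: free_poisson_moments.
Qed.

Lemma poisson_comp x (lam al : R[i]) (t z : fps R[i]) : t 0 = 0 ->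
  (forall n, (0 < n)%N -> free_cumulant1 phi n x = lam * al ^+ n) ->
  fps_comp (moment_series phi x) t = 1 + z <-> poisson_equation lam al t z.
Proof.
move=> t0 kx; rewrite (poisson_moment_series kx) fps_compD fps_compC.
have e := poisson_equation_comp t0 (poisson_seriesP lam al).
split; first by move/addrI <-.
by move=> e'; rewrite (poisson_equation_uniq t0 e e').
Qed.

Variables (p alpha : R[i]).
Hypothesis p0 : p != 0.
Hypothesis alpha0 : alpha != 0.
Hypothesis ab_poisson :
  forall n, (0 < n)%N -> free_cumulant1 phi n (a * b) = p * alpha ^+ n.

(** The first moments are the linear coefficients of the series z below, which
    [moment_series_free_mul] needs to be nonzero. *)
Lemma phi_ab_neq0 : (phi a != 0) && (phi b != 0).
Proof.
have := free_poisson_moments ab_poisson (isT : (0 < 1)%N).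
rewrite !expr1 nc_polyS big_ord0 addr0 nc_poly0 mulr1 free_pair_phiM => e.
by rewrite -negb_or -mulf_eq0 e mulf_neq0.
Qed.

(** The law of a forces u = z / (alpha (1 + z)^2), where z = M_b - 1; then
    t = X / (alpha (1 + z)), and the factor 1 + z cancels in the equation of ab. *)
Lemma bernoulli_of_poisson :
  (forall n, (0 < n)%N -> free_cumulant1 phi n a = 1 * alpha ^+ n) ->
  forall n, (0 < n)%N -> phi (b ^+ n) = p.
Proof.
move=> ka; pose z := moment_series phi b - 1.
have Mb : fps_comp (moment_series phi b) fpsX = 1 + z.
  by rewrite fps_comp_X addrC subrK.
have z0 : z 0 = 0 by rewrite /z fpsB fps1 /moment_series expr0 phi1 subrr.
have zS n : z n.+1 = phi (b ^+ n.+1) by rewrite /z fpsB fps1 subr0.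
have z1 : z 1 != 0 by rewrite zS; case/andP: phi_ab_neq0.
(* V = 1 / (1 + z) *)
pose V := fps_geo (- z).
have VE : (1 + z) * V = 1.
  by rewrite -[z in 1 + z]opprK fps_geoV // fpsN z0 oppr0.
have aE : fpsC alpha * fpsC alpha^-1 = 1 :> fps R[i].
  by rewrite -fpsC_mul divff.
pose u := fpsC alpha^-1 * (z * V ^+ 2); pose t := fpsC alpha^-1 * (fpsX * V).
have u0 : u 0 = 0 by rewrite /u fpsCM fpsM big_ord1 z0 mul0r mulr0.
have t0 : t 0 = 0 by rewrite /t fpsCM fpsXM mulr0.
have uE : fpsC alpha * u = z * V ^+ 2 by rewrite mulrA aE mul1r.
have tE : fpsC alpha * t = fpsX * V by rewrite mulrA aE mul1r.
have Ma : fps_comp (moment_series phi a) u = 1 + z.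
  apply/(poisson_comp _ u0 ka); rewrite /poisson_equation uE fpsC1.
  transitivity (z * ((1 + z) * V) ^+ 2); last by ring.
  by rewrite VE expr1n mulr1.
have X0 : (fpsX : fps R[i]) 0 = 0 by [].
have := moment_series_free_mul phi1 ab_free u0 X0 z0 t0 z1 Ma Mb.
have -> : u * fpsX * (1 + z) = z * t.
  transitivity (z * t * ((1 + z) * V)); last by rewrite VE mulr1.
  by rewrite /u /t; ring.
move=> /(_ erefl)/(poisson_comp _ t0 ab_poisson).
rewrite /poisson_equation tE => e.
have {}e : z = fpsX * (fpsC p + z).
  rewrite {1}e; transitivity (fpsX * (fpsC p + z) * ((1 + z) * V)).
    by ring.
  by rewrite VE mulr1.
elim=> // n IH _; rewrite -zS e fpsXM fpsD.
case: n IH => [|n] IH; first by rewrite z0 addr0.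
by rewrite add0r zS IH.
Qed.

(** The law of b forces v = z / (p + z), where z = M_a - 1; then
    t = X (1 + z) / (p + z), and the factor p + z cancels in the equation of ab. *)
Lemma poisson_of_bernoulli :
  (forall n, (0 < n)%N -> phi (b ^+ n) = p) ->
  forall n, (0 < n)%N -> free_cumulant1 phi n a = 1 * alpha ^+ n.
Proof.
move=> mb; pose z := moment_series phi a - 1.
have Ma : fps_comp (moment_series phi a) fpsX = 1 + z.
  by rewrite fps_comp_X addrC subrK.
have z0 : z 0 = 0 by rewrite /z fpsB fps1 /moment_series expr0 phi1 subrr.
have zS n : z n.+1 = phi (a ^+ n.+1) by rewrite /z fpsB fps1 subr0.
have z1 : z 1 != 0 by rewrite zS; case/andP: phi_ab_neq0.
(* V = 1 / (p + z) *)
pose V := fpsC p^-1 * fps_geo (fpsC (- p^-1) * z).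
have VE : (fpsC p + z) * V = 1.
  have pE : fpsC p * fpsC p^-1 = 1 :> fps R[i] by rewrite -fpsC_mul divff.
  rewrite mulrA mulrDl pE -[RHS](@fps_geoV _ (fpsC (- p^-1) * z)); last first.
    by rewrite fpsCM z0 mulr0.
  congr ((_ + _) * _); apply: funext => n.
  by rewrite mulrC fpsN !fpsCM mulNr opprK.
pose v := z * V; pose t := fpsX * ((1 + z) * V).
have v0 : v 0 = 0 by rewrite /v fpsM big_ord1 z0 mul0r.
have t0 : t 0 = 0 by rewrite /t fpsXM.
have Mb : fps_comp (moment_series phi b) v = 1 + z.
  have := bernoulli_equation_comp v0 (bernoulli_moment_series mb).
  set M := fps_comp _ v => e.
  have e1 : M * (1 - v) = 1 - v + fpsC p * v.
    by apply: (addIr v); rewrite mulrBr mulr1 addrAC [M + v]e; ring.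
  have e2 : (1 + z) * (1 - v) = 1 - v + fpsC p * v.
    have e2 : z = (fpsC p + z) * v by rewrite /v mulrCA VE mulr1.
    by rewrite mulrDl mul1r [z * _]mulrBr mulr1 {1}e2; ring.
  by rewrite -[M]mulr1 -(fps_geoV v0) mulrA e1 -e2 -mulrA fps_geoV // mulr1.
have X0 : (fpsX : fps R[i]) 0 = 0 by [].
have := moment_series_free_mul phi1 ab_free X0 v0 z0 t0 z1 Ma Mb.
have -> : fpsX * v * (1 + z) = z * t by rewrite /v /t; ring.
move=> /(_ erefl)/(poisson_comp _ t0 ab_poisson).
rewrite /poisson_equation => e.
have {}e : poisson_equation 1 alpha fpsX z.
  rewrite /poisson_equation {1}e fpsC1 /t.
  transitivity (fpsC alpha * fpsX * (1 + z) * (1 + z) * ((fpsC p + z) * V)).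
    by ring.
  by rewrite VE mulr1.
apply: free_poisson_cumulants => -[//|n] _.
by rewrite -zS (poisson_equation_uniq _ e (poisson_seriesP 1 alpha)).
Qed.

End FreeFactors.

Theorem proposition4p7 (R : realType) (A : algType R[i]) (phi : {scalar A})
    (phi1 : phi 1 = 1) (fp fb : A) (p alpha : R)
    (hfree : free_pair phi fp fb)
    (hp : 0 < p <= 1) (halpha : 0 < alpha)
    (hprod : free_poisson phi p alpha (fp * fb)) :
  (bernoulli_variable phi p fb -> free_poisson phi 1 alpha fp) /\
  (free_poisson phi 1 alpha fp -> bernoulli_variable phi p fb).
Proof.
have /andP[pgt0 ple1] := hp.
have p0 : p%:C != 0 by rewrite fmorph_eq0 gt_eqF.
have alpha0 : alpha%:C != 0 by rewrite fmorph_eq0 gt_eqF.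
have [_ _ kab] := hprod.
have {}kab n : (0 < n)%N ->
    free_cumulant1 phi n (fp * fb) = p%:C * alpha%:C ^+ n.
  by move=> n0; rewrite kab // rmorphM rmorphXn.
split=> [[_ mb]|[_ _ ka]].
  split=> // n n0; rewrite rmorphM rmorphXn rmorph1.
  exact: (poisson_of_bernoulli phi1 hfree p0 alpha0 kab).
split=> [|n n0]; first by rewrite ltW.
apply: (bernoulli_of_poisson phi1 hfree p0 alpha0 kab) => // m m0.
by rewrite ka // rmorphM rmorphXn rmorph1.
Qed.
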